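(* Let $(T(t))_{t\ge0}$ be a bi-continuous semigroup with negative growth bound and generator $A$ on a triple $(X_0,\|\cdot\|,\tau)$ satisfying Assumption (S) of the context. For $\alpha\in(0,1)$ we have \[ X_\alpha=\Bigl\{x\in X_0:\ \tau\text{-}\lim_{\lambda\to\infty}\lambda^\alpha AR(\lambda,A)x=0\ \text{ and }\ \sup_{\lambda>0}\|\lambda^\alpha AR(\lambda,A)x\|<\infty\Bigr\}. \]
   Context: Assumption (S) on a triple $(X_0,\|\cdot\|,\tau)$: $(X_0,\|\cdot\|)$ is a Banach space; (1) $\tau$ is a locally convex Hausdorff topology coarser than the norm topology; (2) $\tau$ is sequentially complete on the closed unit ball; (3) $\|x\|=\sup\{|\varphi(x)|:\varphi\in(X_0,\tau)',\|\varphi\|\le1\}$. A bi-continuous semigroup on such a triple is a family $(T(t))_{t\ge0}$ in $\mathscr{L}(X_0)$ with: $T(0)=I$, $T(t+s)=T(t)T(s)$; $t\mapsto T(t)x$ $\tau$-continuous for every $x$; $\|T(t)\|\le Me^{\omega t}$ for some $M\ge1$, $\omega\in\mathbb{R}$; and for each norm-bounded $\tau$-null sequence $(x_n)$ and $t_0\ge0$, $T(s)x_n\to0$ in $\tau$ uniformly for $s\in[0,t_0]$. Negative growth bound means that $\omega<0$ can be chosen. Generator: $Ax:=\tau\text{-}\lim_{t\to0}\frac{T(t)x-x}{t}$, $D(A):=\{x:\tau\text{-}\lim_{t\to0}\frac{T(t)x-x}{t}\text{ exists and }\sup_{t\in(0,1]}\frac{\|T(t)x-x\|}{t}<\infty\}$.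 For $\lambda$ larger than the growth bound, $\lambda\in\rho(A)$ and $R(\lambda,A)x=\int_0^\infty e^{-\lambda s}T(s)x\,ds$ as a $\tau$-improper integral. $X_\alpha:=\Bigl\{x\in X_0:\tau\text{-}\lim_{t\to0}\frac{T(t)x-x}{t^\alpha}=0\text{ and }\sup_{t>0}\frac{\|T(t)x-x\|}{t^\alpha}<\infty\Bigr\}$. *)

(* Defs.v *)
From HB Require Import structures.
From mathcomp Require Import all_boot all_order all_algebra.
From mathcomp Require Import complex.
From mathcomp Require Import all_classical all_reals all_analysis.

Set Implicit Arguments.
Unset Strict Implicit.
Unset Printing Implicit Defensive.

Import Order.TTheory GRing.Theory Num.Theory.
Import numFieldNormedType.Exports.

Local Open Scope classical_set_scope.
Local Open Scope ring_scope.

(* The scalar field [K] of the Banach space is either [R] or [R[i]]; norms take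
   their values in [K], so real quantities are injected by [ofR]. *)
Variant real_or_complex (R : realType) : numFieldType -> Type :=
| RealScalars : real_or_complex R R
| ComplexScalars : real_or_complex R R[i].

Definition ofR (R : realType) (K : numFieldType) (k : real_or_complex R K) :
    R -> K :=
  match k in real_or_complex _ K return R -> K with
  | RealScalars => id
  | ComplexScalars => real_complex R
  end.

(* A triple (X_0, ||.||, tau) is given by the Banach space [X], the same vector
   space [Xtau] with the locally convex topology tau, and the identity map
   [j : X -> Xtau], a linear bijection. *)
Section Triple.
Context (K : numFieldType) (X : completeNormedModType K) (Xtau : tvsType K).
Context (j : {linear X -> Xtau}).

Definition norm_bounded (u : nat -> X) := has_ubound [set `|u n| | n in setT].

(* The uniformity carried by a [tvsType] is only required to induce its
   topology, so Cauchy sequences are stated with neighborhoods of 0 instead. *)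
Definition tau_cauchy (u : nat -> X) := forall U : set Xtau, nbhs 0 U ->
  exists N, forall m n, (N <= m)%N -> (N <= n)%N -> U (j (u m - u n)).

Definition tau_functional_unit_ball : set {linear Xtau -> K^o} :=
  [set phi : {linear Xtau -> K^o} |
    continuous phi /\ forall x : X, `|phi (j x)| <= `|x|].

Record assumption_S : Prop := AssumptionS {
  tau_bij : bijective j ;
  tau_coarser : continuous j ;
  tau_hausdorff : hausdorff_space Xtau ;
  tau_seq_complete_ball : forall u : nat -> X,
    (forall n, `|u n| <= 1) -> tau_cauchy u ->
    exists l : X, `|l| <= 1 /\ j (u n) @[n --> \oo] --> j l ;
  tau_norming : forall x : X,
    supremums [set `|phi (j x)| | phi in tau_functional_unit_ball] `|x| }.

End Triple.

(* The family [T] is indexed by all of [R], but its values at negative times are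
   unconstrained and never used. *)
Section Semigroup.
Context (R : realType) (K : numFieldType) (k : real_or_complex R K).
Context (X : completeNormedModType K) (Xtau : tvsType K).
Context (j : {linear X -> Xtau}) (T : R -> {linear X -> X}).

Definition growth_estimate (w : R) := exists2 M : R, 1 <= M &
  forall t, 0 <= t -> forall x, `|T t x| <= ofR k (M * expR (w * t)) * `|x|.

Record bicontinuous_semigroup : Prop := BicontinuousSemigroup {
  sg_bounded : forall t, 0 <= t -> continuous (T t) ;
  sg0 : forall x, T 0 x = x ;
  sgD : forall t s, 0 <= t -> 0 <= s -> forall x, T (t + s) x = T t (T s x) ;
  sg_tau_continuous : forall x,
    {within `[0, +oo[, continuous (fun t => j (T t x))} ;
  sg_exp_bounded : exists w, growth_estimate w ;
  sg_bi_equicontinuous : forall (u : nat -> X) (t0 : R),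
    norm_bounded u -> j (u n) @[n --> \oo] --> (0 : Xtau) -> 0 <= t0 ->
    forall U : set Xtau, nbhs 0 U ->
      \forall n \near \oo, forall s, 0 <= s <= t0 -> U (j (T s (u n))) }.

Definition negative_growth_bound := exists2 w : R, w < 0 & growth_estimate w.

Definition diff_quotient (h : R -> R) (x : X) (t : R) : X :=
  (ofR k (h t))^-1 *: (T t x - x).

Definition generator_lim (x y : X) :=
  j (diff_quotient id x t) @[t --> 0^'+] --> j y.

Definition generator_dom : set X := [set x |
  (exists y, generator_lim x y) /\
  has_ubound [set `|diff_quotient id x t| | t in `]0, 1]]].

(* equal to 0 off the set of points where the defining limit exists *)
Definition generator (x : X) : X := xget 0 (generator_lim x).

(* R(lambda, A) x, the preimage of x under lambda - A : D(A) -> X_0; equal to 0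
   if there is no preimage *)
Definition resolvent (lambda : K) (x : X) : X :=
  xget 0 [set y | generator_dom y /\ lambda *: y - generator y = x].

Definition holder_space (a : R) : set X := [set x |
  j (diff_quotient (@powR R ^~ a) x t) @[t --> 0^'+] --> (0 : Xtau) /\
  has_ubound [set `|diff_quotient (@powR R ^~ a) x t| | t in `]0, +oo[]].

Definition scaled_AR (a : R) (x : X) (lambda : R) : X :=
  ofR k (lambda `^ a) *: generator (resolvent (ofR k lambda) x).

End Semigroup.

(* Main.v *)
(* Write S = lam R(lam, A) x, the mean of T(s) x under the exponential law of
   rate lam, so that A R(lam, A) x = S - x. If p is tau-continuous or the norm and
   p (T(s) x - x) <= a + b s for all s >= 0, then p (S - x) <= a + b / lam; the
   majorants s^al <= lam^(-al) (1 + lam s), and s^al <= d^(al - 1) s for s >= d,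
   then bound S - x by a constant times lam^(-al). Conversely, with lam = 1 / t,
   T(t) x - x = (T(t) - 1) S - (T(t) - 1) (S - x), whose first term is
   lam \int_0^t T(s) (S - x) ds, so T(t) x - x is controlled by T(s) (S - x),
   s <= t; local bi-equicontinuity gives the tau-limit.

   No vector-valued integral is needed: S is the tau-limit, along h = 2^-m, of the
   Abel means (1 - q) \sum_k q^k T(k h) x with q = e^(-lam h), each of which is
   the solution y of y - q T(h) y = (1 - q) x. *)
Require Import Defs.
From HB Require Import structures.
From mathcomp Require Import all_boot all_order all_algebra.
From mathcomp Require Import complex.
From mathcomp Require Import all_classical all_reals all_analysis.
From mathcomp Require Import ring lra.
Import Order.TTheory GRing.Theory Num.Theory.
Import numFieldNormedType.Exports.
Local Open Scope classical_set_scope.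
Local Open Scope ring_scope.

Set Implicit Arguments.
Unset Strict Implicit.
Unset Printing Implicit Defensive.

(** * Linear identities in a module, by comparison of coefficients *)

(** The hypotheses control [tau] along norm-bounded sequences: completeness concerns bounded Cauchy
    sequences, equicontinuity bounded null sequences, and a single [T t] is not assumed
    tau-continuous. Hence every limit is taken along a bounded sequence, and moving [T t] past a
    limit goes through equicontinuity. An Abel mean is reached by iterating y -> (1 - q) x + q T(h)
    y. If M > 1 this map need not contract the norm, so whole orbits are bounded at once. Halving
    the step is harmless because a mean with a fine step is also a mean with the coarse step, for a
    datum tau-close to x. [resolvent] is a choice of preimage, so identifying it with S / lam also
    requires that lam is not an eigenvalue of A; Abel means give this too, since an eigenvector
    would be the mean of arbitrarily small data. Everything is carried out over real scalars, with
    real seminorms in place of the K-valued norm and the neighborhoods of [tau]; the negative growth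
    bound enters as one constant M bounding all [T t]. *)

Inductive lin_expr (R : Type) :=
| LAtom of nat | LZero | LAdd of lin_expr R & lin_expr R
| LOpp of lin_expr R | LScale of R & lin_expr R.
Arguments LAtom {R}. Arguments LZero {R}.

Fixpoint lin_eval (R : pzRingType) (V : lmodType R) (env : seq V)
    (e : lin_expr R) : V :=
  match e with
  | LAtom i => env`_i
  | LZero => 0
  | LAdd a b => lin_eval env a + lin_eval env b
  | LOpp a => - lin_eval env a
  | LScale c a => c *: lin_eval env a
  end.

Fixpoint lin_coef (R : pzRingType) (e : lin_expr R) (i : nat) : R :=
  match e with
  | LAtom j => if eqn j i then 1 else 0
  | LZero => 0
  | LAdd a b => lin_coef a i + lin_coef b i
  | LOpp a => - lin_coef a i
  | LScale c a => c * lin_coef a i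
  end.

(** Recursion on [n] lets this compute, for a concrete environment, to an explicit conjunction of
    scalar equations. *)
Fixpoint lin_coef_eq (R : pzRingType) (e1 e2 : lin_expr R) (n : nat) : Prop :=
  match n with
  | 0 => True
  | m.+1 => lin_coef e1 m = lin_coef e2 m /\ lin_coef_eq e1 e2 m
  end.

Lemma lin_evalE (R : pzRingType) (V : lmodType R) (env : seq V) e :
  lin_eval env e = \sum_(i < size env) lin_coef e i *: env`_i.
Proof.
elim: e => [j||a IHa b IHb|a IHa|c a IHa] /=; rewrite ?IHa ?IHb.
- case: (ltnP j (size env)) => jn.
    rewrite (bigD1 (Ordinal jn)) //= eqnE eqxx scale1r big1 ?addr0 // => i ij.
    by move: ij; rewrite eq_sym -val_eqE /= => /negPf->; rewrite scale0r.
  rewrite nth_default // big1 // => i _.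
  by rewrite eqnE ifN ?scale0r // neq_ltn (leq_trans (ltn_ord i) jn) orbT.
- by rewrite big1 // => i _; rewrite scale0r.
- by rewrite -big_split; apply: eq_bigr => i _; rewrite scalerDl.
- by rewrite -sumrN; apply: eq_bigr => i _; rewrite scaleNr.
- by rewrite scaler_sumr; apply: eq_bigr => i _; rewrite scalerA.
Qed.

Lemma lin_eval_eq (R : pzRingType) (V : lmodType R) (env : seq V) e1 e2 :
  lin_coef_eq e1 e2 (size env) -> lin_eval env e1 = lin_eval env e2.
Proof.
move=> h; rewrite !lin_evalE; apply: eq_bigr => i _; congr (_ *: _).
elim: (size env) h i => [_ []//|n IH /= [hn h] [i /=]].
by rewrite ltnS leq_eqVlt => /orP[/eqP->//|lin]; exact: (IH h (Ordinal lin)).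
Qed.

Ltac lin_index x env k :=
  lazymatch env with
  | x :: _ => k
  | _ :: ?e => lin_index x e (S k)
  end.
Ltac lin_add x env :=
  match env with
  | _ => let _ := lin_index x env O in env
  | _ => let rec snoc l := lazymatch l with
           | nil => constr:(x :: nil)
           | ?y :: ?m => let r := snoc m in constr:(y :: r) end in snoc env
  end.
Ltac lin_atoms t env :=
  lazymatch t with
  | (?a + ?b)%R => let e := lin_atoms a env in lin_atoms b e
  | (- ?a)%R => lin_atoms a env
  | (_ *: ?a)%R => lin_atoms a env
  | 0%R => env
  | ?x => lin_add x env
  end.
Ltac lin_quote R t env :=
  lazymatch t with
  | (?a + ?b)%R => let ea := lin_quote R a env in let eb := lin_quote R b env in
                   constr:(@LAdd R ea eb)
  | (- ?a)%R => let ea := lin_quote R a env in constr:(@LOpp R ea)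
  | (?c *: ?a)%R => let ea := lin_quote R a env in constr:(@LScale R c ea)
  | 0%R => constr:(@LZero R)
  | ?x => let i := lin_index x env O in constr:(@LAtom R i)
  end.
(** Subterms other than sums, opposites and multiples become atoms; what remains is a scalar goal
    per atom, for [ring] or [field]. *)
Ltac lmodule R :=
  lazymatch goal with
  | |- @eq ?V ?l ?r =>
    let env0 := lin_atoms l (@nil V) in
    let env := lin_atoms r env0 in
    let el := lin_quote R l env in
    let er := lin_quote R r env in
    apply: (@lin_eval_eq _ _ env el er);
    cbv [size lin_coef_eq lin_coef eqn]; repeat split
  end.

(** * Seminorms *)

Section Seminorms.
Context {R : realType} {V : lmodType R}.

Record seminorm (p : V -> R) : Prop := Seminorm {
  seminormD : forall x y, p (x + y) <= p x + p y ;
  seminormZ : forall a x, p (a *: x) = `|a| * p x }.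

Context (p : V -> R) (pP : seminorm p).

Lemma seminorm0 : p 0 = 0.
Proof. by rewrite -(scale0r (0 : V)) (seminormZ pP) normr0 mul0r. Qed.

Lemma seminormN x : p (- x) = p x.
Proof. by rewrite -scaleN1r (seminormZ pP) normrN1 mul1r. Qed.

Lemma seminorm_ge0 x : 0 <= p x.
Proof.
have := seminormD pP x (- x); rewrite subrr seminorm0 seminormN => h; lra.
Qed.

Lemma seminormB x y : p (x - y) <= p x + p y.
Proof. by rewrite -[p y]seminormN (seminormD pP). Qed.

Lemma seminorm_distC x y : p (x - y) = p (y - x).
Proof. by rewrite -seminormN opprB. Qed.

Lemma seminorm_comp (L : {linear V -> V}) : seminorm (p \o L).
Proof.
split=> [x y|a x] /=; first by rewrite linearD (seminormD pP).
by rewrite linearZ (seminormZ pP).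
Qed.

End Seminorms.

(** * Geometric and exponential weights *)

Section ExponentialBounds.
Context {R : realType}.
Implicit Types (q x D e : R).

Lemma geometric_small q D e : 0 <= q < 1 -> 0 < e ->
  exists N, q ^+ N * D <= e.
Proof.
move=> /andP[q0 q1] e0.
have /cvgrPdist_le/(_ e e0)[N _ hN] : geometric D q @ \oo --> (0 : R).
  by apply: cvg_geometric; rewrite ger0_norm.
exists N; have := hN N (leqnn N); rewrite /geometric /= sub0r normrN mulrC.
exact: le_trans (ler_norm _).
Qed.

Lemma expRN_gt0_lt1 x : 0 < x -> 0 < expR (- x) < 1.
Proof. by move=> x0; rewrite expR_gt0 /= expR_lt1 oppr_lt0. Qed.

(** This is 1 + x <= e^x multiplied by e^(-x). With x = lam h it compares the geometric weights of
    step h with the exponential law of rate lam. *)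
Lemma expR_mean_ub x : 0 < x -> x * expR (- x) <= 1 - expR (- x).
Proof.
move=> x0; have := expR_ge1Dx x; have := expRxMexpNx_1 x.
have := expR_gt0 (- x) => h1 h2 h3; nra.
Qed.

Lemma expR_mean_lb x : 0 <= x -> 1 - expR (- x) <= x.
Proof. by move=> x0; have := expR_ge1Dx (- x) => h; lra. Qed.

End ExponentialBounds.

(** * A norm together with a coarser topology given by seminorms *)

Section SeminormedSpace.
Context {R : realType} {V : lmodType R} (nrm : V -> R) (P : set (V -> R)).

Definition tau_cvg (u : nat -> V) (l : V) := forall p, P p ->
  forall e, 0 < e -> exists N, forall n, (N <= n)%N -> p (u n - l) <= e.

Definition tau_cvg0 (Y : R -> V) (l : V) := forall p, P p ->
  forall e, 0 < e -> exists2 d, 0 < d & forall r, 0 < r < d -> p (Y r - l) <= e.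

(** [P] generates the topology. Completeness is stated for balls of every radius and keeps the limit
    in the same ball, which is the source of lower semicontinuity of the norm. *)
Record two_topologies : Prop := TwoTopologies {
  nrm_seminorm : seminorm nrm ;
  tau_seminorm : forall p, P p -> seminorm p ;
  tau_dominated : forall p, P p -> exists2 C, 0 <= C & forall x, p x <= C * nrm x ;
  tau_separated : forall x, (forall p, P p -> p x = 0) -> x = 0 ;
  tau_complete : forall u B, (forall n, nrm (u n) <= B) ->
    (forall p, P p -> forall e, 0 < e -> exists N, forall m n,
       (N <= m)%N -> (N <= n)%N -> p (u m - u n) <= e) ->
    exists2 l, nrm l <= B & tau_cvg u l }.

(* The two instances are [nrm] and the members of [P]: estimates proved for all
   such [p] yield norm bounds and tau-limits at once. *)
Record lsc_seminorm (p : V -> R) : Prop := LscSeminorm {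
  lsc_seminormP : seminorm p ;
  lsc_dominated : exists2 C, 0 <= C & forall x, p x <= C * nrm x ;
  lsc_le : forall u B l a, (forall n, nrm (u n) <= B) -> tau_cvg u l ->
    (forall n, p (u n) <= a) -> p l <= a }.

Hypothesis XP : two_topologies.

Lemma tau_cvg_unique u l l' : tau_cvg u l -> tau_cvg u l' -> l = l'.
Proof.
move=> ul ul'; apply/eqP; rewrite -subr_eq0; apply/eqP.
apply: (tau_separated XP) => p pP; have ps := tau_seminorm XP pP.
apply/eqP; rewrite eq_le seminorm_ge0 // andbT; apply/ler_addgt0Pr => e e0.
have e2 : 0 < e / 2 by lra.
have [N hN] := ul p pP _ e2; have [N' hN'] := ul' p pP _ e2.
have := hN (maxn N N') (leq_maxl _ _); have := hN' (maxn N N') (leq_maxr _ _).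
have := seminormB ps (u (maxn N N') - l') (u (maxn N N') - l).
rewrite (_ : _ - _ = l - l'); first by move=> h1 h2 h3; lra.
by lmodule R; ring.
Qed.

Lemma tau_cvg_cauchy u l p e : tau_cvg u l -> P p -> 0 < e ->
  exists N, forall m n, (N <= m)%N -> (N <= n)%N -> p (u m - u n) <= e.
Proof.
move=> ul pP e0; have ps := tau_seminorm XP pP.
have e2 : 0 < e / 2 by lra.
have [N hN] := ul p pP _ e2; exists N => m n mN nN.
have := seminormB ps (u m - l) (u n - l); have := hN m mN; have := hN n nN.
rewrite (_ : _ - _ = u m - u n); first by move=> h1 h2 h3; lra.
by lmodule R; ring.
Qed.

(** If all [u n] lie in the ball of radius [a], completeness of that ball gives a limit inside it,
    and limits are unique. *)
Lemma lsc_nrm : lsc_seminorm nrm.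
Proof.
split; first exact: (nrm_seminorm XP).
  by exists 1 => // x; rewrite mul1r.
move=> u B l a _ ul ua.
have [l' l'a ul'] := tau_complete XP ua (fun p pP e => tau_cvg_cauchy ul pP).
by rewrite (tau_cvg_unique ul ul').
Qed.

Lemma lsc_tau p : P p -> lsc_seminorm p.
Proof.
move=> pP; have ps := tau_seminorm XP pP; split=> //.
  exact: (tau_dominated XP pP).
move=> u B l a _ ul ua; apply/ler_addgt0Pr => e e0.
have [N hN] := ul p pP e e0; have := hN N (leqnn _).
have := seminormB ps (u N) (u N - l); have := ua N.
rewrite (_ : _ - _ = l); first by move=> h1 h2 h3; lra.
by lmodule R; ring.
Qed.

End SeminormedSpace.

(** * Abel means of a bounded bi-continuous semigroup *)

Section BoundedSemigroup.
Context {R : realType} {V : lmodType R} (nrm : V -> R) (P : set (V -> R)).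
Context (T : R -> {linear V -> V}) (M : R).

Record bounded_semigroup : Prop := BoundedSemigroup {
  bs_ge1 : 1 <= M ;
  bs0 : forall x, T 0 x = x ;
  bsD : forall t s, 0 <= t -> 0 <= s -> forall x, T (t + s) x = T t (T s x) ;
  bs_bound : forall t, 0 <= t -> forall x, nrm (T t x) <= M * nrm x ;
  bs_cvg0 : forall x, tau_cvg0 P (fun t => T t x) x ;
  bs_equi : forall u B, (forall n, nrm (u n) <= B) -> tau_cvg P u 0 ->
    forall p, P p -> forall t0 e, 0 <= t0 -> 0 < e ->
    exists N, forall n, (N <= n)%N -> forall s, 0 <= s <= t0 ->
      p (T s (u n)) <= e }.

Hypothesis XP : two_topologies nrm P.
Hypothesis TP : bounded_semigroup.

Let nrm_ge0 x : 0 <= nrm x.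
Proof. exact: seminorm_ge0 (nrm_seminorm XP) x. Qed.

Let M_ge0 : 0 <= M.
Proof. by rewrite (le_trans _ (bs_ge1 TP)). Qed.

Let TB t x y : T t (x - y) = T t x - T t y.
Proof. exact: linearB. Qed.

Let TZ t a x : T t (a *: x) = a *: T t x.
Proof. exact: linearZZ. Qed.

(** Equicontinuity is given for sequences; to use it as r -> 0, a failure is turned into points r_n
    <= 1/(n+1) along which [Y] is a bounded null sequence violating it. *)
Lemma tau_cvg0_equi (Y : R -> V) B :
  (forall r, 0 < r <= 1 -> nrm (Y r) <= B) -> tau_cvg0 P Y 0 ->
  forall p, P p -> forall t0 e, 0 <= t0 -> 0 < e ->
  exists2 d, 0 < d & forall r, 0 < r < d -> forall s, 0 <= s <= t0 ->
    p (T s (Y r)) <= e.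
Proof.
move=> YB Y0 p pP t0 e t00 e0; apply: contrapT => H.
have /choice[r hr] : forall n : nat, exists r, 0 < r <= n.+1%:R^-1 /\
    exists2 s, 0 <= s <= t0 & e < p (T s (Y r)).
  move=> n; apply: contrapT => Hn; apply: H.
  exists n.+1%:R^-1; first by rewrite invr_gt0 ltr0n.
  move=> r /andP[r0 rn] s st; rewrite leNgt; apply/negP => hs; apply: Hn.
  by exists r; split; [rewrite r0 ltW|exists s].
have Yr n : nrm (Y (r n)) <= B.
  have [/andP[r0 rn] _] := hr n; apply: YB; rewrite r0 (le_trans rn) //.
  by rewrite invf_le1 ?ltr0n // ler1n.
have [|N hN] := bs_equi TP Yr _ pP t00 e0.
  move=> p' p'P e' e'0; have [d d0 hd] := Y0 p' p'P e' e'0.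
  have [N _ hN] := near_infty_natSinv_lt (PosNum d0).
  exists N => n nN; apply: hd; have [/andP[-> rn] _] := hr n.
  by rewrite (le_lt_trans rn (hN n nN)).
have [_ [s st]] := hr N; apply/negP; rewrite -leNgt; exact: (hN N).
Qed.

(** Stands in for uniform continuity of s -> T(s) x on compact intervals: it bounds T(s + r) x -
    T(s) x uniformly in s <= t0. *)
Lemma bs_unif_cvg0 x p (t0 e : R) : P p -> 0 <= t0 -> 0 < e ->
  exists2 d, 0 < d & forall r, 0 <= r < d -> forall s, 0 <= s <= t0 ->
    p (T s (T r x - x)) <= e.
Proof.
move=> pP t00 e0.
have [||d d0 hd] := @tau_cvg0_equi (fun r => T r x - x) (M * nrm x + nrm x) _ _
  p pP t0 e t00 e0.
- move=> r /andP[/ltW r0 _].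
  have := seminormB (nrm_seminorm XP) (T r x) x.
  by have := bs_bound TP r0 x => h1 h2; lra.
- move=> p' p'P e' e'0; have [d d0 hd] := bs_cvg0 TP x p'P e'0.
  by exists d => // r rd; rewrite subr0; exact: hd.
exists d => // r /andP[]; rewrite le_eqVlt => /predU1P[<- _ s _|r0 rd].
  by rewrite (bs0 TP) subrr linear0 (seminorm0 (tau_seminorm XP pP)) ltW.
by apply: hd; rewrite r0.
Qed.

Section AbelMeans.
Context (lam : R) (lam0 : 0 < lam).

(* [y] is the Abel mean [(1 - q) * \sum_k q ^+ k * T (k h) x] with
   [q = expR (- lam h)], a Riemann sum of [lam * \int e^(-lam s) T(s) x ds] *)
Definition abel_mean (h : R) (x y : V) :=
  y - expR (- (lam * h)) *: T h y = (1 - expR (- (lam * h))) *: x.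

Lemma abel_weight (h : R) : 0 < h -> 0 < expR (- (lam * h)) < 1.
Proof. by move=> h0; rewrite expRN_gt0_lt1 // mulr_gt0. Qed.

Lemma abel_meanB (h : R) x y x' y' : abel_mean h x y -> abel_mean h x' y' ->
  abel_mean h (x - x') (y - y').
Proof.
rewrite /abel_mean => H H'; rewrite TB !scalerBr -H -H'.
by lmodule R; ring.
Qed.

(* Summing the telescope; [c] solves [c = q * (b h + c)], the mean of [b k h]
   under the geometric weights. *)
Lemma abel_mean_partial p v x y (a b h : R) N (q := expR (- (lam * h)))
    (c := b * h * q / (1 - q)) : seminorm p -> 0 < h -> abel_mean h x y ->
  (forall k, (k < N)%N -> p (T (k%:R * h) x - v) <= a + b * (k%:R * h)) ->
  p (y - v - q ^+ N *: (T (N%:R * h) y - v)) <=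
    a + c - q ^+ N * (a + b * (N%:R * h) + c).
Proof.
move=> ps h0 H; have /andP[q0 q1] : 0 < q < 1 := abel_weight h0.
have Hq : y - q *: T h y = (1 - q) *: x := H.
have q1' : 1 - q != 0 by rewrite subr_eq0 gt_eqF.
elim: N => [_|N IH hN].
  rewrite mul0r (bs0 TP) expr0 scale1r subrr (seminorm0 ps) !(mul0r, mulr0).
  by rewrite mul1r; lra.
have -> : y - v - q ^+ N.+1 *: (T (N.+1%:R * h) y - v) =
    (y - v - q ^+ N *: (T (N%:R * h) y - v)) +
    (q ^+ N * (1 - q)) *: (T (N%:R * h) x - v).
  (* [T (N h)] applied to the equation of [y]: one more power of [q] is traded for one more term of
     the sum. *)
  have E : q *: T (N%:R * h) (T h y) =
      T (N%:R * h) y - (1 - q) *: T (N%:R * h) x.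
    rewrite -[q *: T _ _]TZ -[(1 - q) *: T _ _]TZ -TB -Hq.
    by congr (T _ _); lmodule R; ring.
  have -> : N.+1%:R * h = N%:R * h + h by rewrite -natr1 mulrDl mul1r.
  have Nh0 : 0 <= N%:R * h by rewrite mulr_ge0 // ltW.
  rewrite (bsD TP) ?(ltW h0) //.
  transitivity (y - v - (q ^+ N *: (q *: T (N%:R * h) (T h y))
                         - q ^+ N.+1 *: v)).
    by rewrite exprS; lmodule R; ring.
  by rewrite E exprS; lmodule R; ring.
apply: le_trans (seminormD ps _ _) _.
have qN : 0 <= q ^+ N * (1 - q) by rewrite mulr_ge0 ?exprn_ge0 //; lra.
rewrite (seminormZ ps) (ger0_norm qN).
have := ler_wpM2l qN (hN N (leqnn _)).
have := IH (fun k kN => hN k (leqW kN)).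
have Ec : c = b * h * q + q * c by rewrite /c; field.
set t := q ^+ N in qN *; move=> h1 h2.
suff : a + c - t * (a + b * (N%:R * h) + c) + t * (1 - q) * (a + b * (N%:R * h))
  = a + c - q ^+ N.+1 * (a + b * (N.+1%:R * h) + c) by move=> <-; lra.
rewrite exprS -/t -natr1.
have -> : c = b * h * q / (1 - q) by [].
by field.
Qed.

(** As N grows in the partial bound, the remainder carries the factor q^N and vanishes because
    orbits are bounded; and c <= b / lam follows from lam h q <= 1 - q. *)
Lemma abel_mean_le p v x y (a b h : R) : seminorm p ->
  (exists2 C, 0 <= C & forall z, p z <= C * nrm z) ->
  0 < h -> 0 <= a -> 0 <= b -> abel_mean h x y ->
  (forall s, 0 <= s -> p (T s x - v) <= a + b * s) ->
  p (y - v) <= a + b / lam.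
Proof.
move=> ps [C C0 pC] h0 a0 b0 H hs; apply/ler_addgt0Pr => e e0.
have /andP[q0 q1] := abel_weight h0; set q := expR _ in q0 q1.
have [N hN] := @geometric_small _ q (C * (M * nrm y) + p v) e
  (ltac:(by rewrite ltW)) e0.
have hh (k : nat) : 0 <= k%:R * h by rewrite mulr_ge0 // ltW.
have := abel_mean_partial ps h0 H (fun k (_ : (k < N)%N) => hs _ (hh k)).
rewrite -/q; set c := b * h * q / (1 - q) => h1.
have c0 : 0 <= c by rewrite /c divr_ge0 ?mulr_ge0 // ltW // subr_gt0.
have cb : c <= b / lam.
  rewrite /c -!mulrA ler_wpM2l // mulrA ler_pdivrMr ?subr_gt0 //.
  rewrite -(ler_pM2l lam0) !mulrA divff ?gt_eqF // mul1r.
  by apply: expR_mean_ub; rewrite mulr_gt0.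
have qN : 0 <= q ^+ N by rewrite exprn_ge0 ?ltW.
have := seminormD ps (y - v - q ^+ N *: (T (N%:R * h) y - v))
  (q ^+ N *: (T (N%:R * h) y - v)).
rewrite subrK (seminormZ ps) (ger0_norm qN) => h2.
have h3 : p (T (N%:R * h) y - v) <= C * (M * nrm y) + p v.
  apply: le_trans (seminormB ps _ _) _; rewrite lerD2r.
  by apply: le_trans (pC _) _; rewrite ler_wpM2l // (bs_bound TP).
have h4 := ler_wpM2l qN h3.
have h5 : 0 <= q ^+ N * (a + b * (N%:R * h) + c).
  by rewrite mulr_ge0 // !addr_ge0 // mulr_ge0.
lra.
Qed.

Lemma abel_mean_nrm (h : R) x y : 0 < h -> abel_mean h x y -> nrm y <= M * nrm x.
Proof.
move=> h0 H; have := @abel_mean_le nrm 0 x y (M * nrm x) 0 h (nrm_seminorm XP).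
rewrite mul0r addr0 subr0; apply=> //; first by exists 1 => // z; rewrite mul1r.
  by rewrite mulr_ge0.
by move=> s s0; rewrite subr0 mul0r addr0 (bs_bound TP).
Qed.

(** An Abel mean sees essentially a bounded time interval. The point is uniformity: [t0] depends
    neither on the step nor on the datum, so both may vary afterwards. *)
Lemma abel_mean_small p (B e : R) : P p -> 0 < e ->
  exists2 t0, 0 <= t0 & forall h x y, 0 < h -> nrm x <= B ->
    (forall s, 0 <= s <= t0 -> p (T s x) <= e) -> abel_mean h x y ->
    p y <= e + e.
Proof.
move=> pP e0; have ps := tau_seminorm XP pP.
have [C C0 pC] := tau_dominated XP pP.
pose D := C * (M * Num.max B 0).
have D0 : 0 <= D by rewrite !mulr_ge0 // le_max lexx orbT.
(* Beyond [t0] the crude bound [D] is at most [D / t0 * s], whose mean D / (t0 lam) is at most [e];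
   the summand 1 keeps [t0] positive when [D = 0]. *)
pose t0 := D / (lam * e) + 1.
have t00 : 0 < t0.
  by rewrite /t0 ltr_wpDl // divr_ge0 // ltW // mulr_gt0.
exists t0 => [|h x y h0 xB hs H]; first exact: ltW.
have := @abel_mean_le p 0 x y e (D / t0) h ps (tau_dominated XP pP) h0.
rewrite subr0 => /(_ (ltW e0) _ H) h1.
apply: le_trans (h1 _ _) _; first by rewrite divr_ge0 // ltW.
  move=> s s0; rewrite subr0; have [st|st] := leP s t0.
    by rewrite (le_trans (hs s _)) ?s0 // lerDl mulr_ge0 // divr_ge0 // ltW.
  have : p (T s x) <= D.
    rewrite (le_trans (pC _)) // ler_wpM2l // (le_trans (bs_bound TP s0 _)) //.
    by rewrite ler_wpM2l // le_max xB.
  have : D <= D / t0 * s.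
    by rewrite mulrAC ler_pdivlMr // ler_wpM2l // ltW.
  lra.
rewrite lerD2l ler_pdivrMr // ler_pdivrMr //.
have -> : e * lam * t0 = D + e * lam by rewrite /t0; field; rewrite !gt_eqF.
by rewrite lerDl ltW // mulr_gt0.
Qed.

Lemma abel_mean_exists (h : R) x : 0 < h -> exists y, abel_mean h x y.
Proof.
move=> h0; have /andP[q0 q1] := abel_weight h0.
set q := expR _ in q0 q1.
pose y := fix y n := if n is m.+1 then (1 - q) *: x + q *: T h (y m) else 0.
have yS n : y n.+1 = (1 - q) *: x + q *: T h (y n) by [].
have nrmP := nrm_seminorm XP.
(* Bounding T(s) (y n) for all s at once avoids losing a factor [M] at each iteration: T(s) T(h) is
   again a single operator of the semigroup. *)
have yB n s : 0 <= s -> nrm (T s (y n)) <= M * nrm x.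
  suff : 0 <= s -> nrm (T s (y n)) <= (1 - q ^+ n) * (M * nrm x).
    move=> /[apply] h1; apply: le_trans h1 _; rewrite ler_piMl ?mulr_ge0 //.
    by rewrite gerBl exprn_ge0 // ltW.
  elim: n s => [|n IH] s s0; first by rewrite linear0 seminorm0 // expr0 subrr mul0r.
  rewrite yS linearD !TZ -(bsD TP) ?(ltW h0) //.
  apply: le_trans (seminormD nrmP _ _) _; rewrite !(seminormZ nrmP).
  have q1' : 0 <= 1 - q by rewrite subr_ge0 ltW.
  rewrite (gtr0_norm q0) (ger0_norm q1').
  have h1 := bs_bound TP s0 x; have h2 := IH (s + h) (addr_ge0 s0 (ltW h0)).
  rewrite exprS; move: h1 h2; set w := M * _ => h1 h2.
  have := ler_wpM2l q1' h1; have := ler_wpM2l (ltW q0) h2.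
  by move=> h3 h4; lra.
have y_nrm n : nrm (y n) <= M * nrm x by rewrite -[y n](bs0 TP) yB.
have yD n k : y (n + k)%N - y n = q ^+ n *: T (n%:R * h) (y k).
  elim: n => [|n IH]; first by rewrite mul0r (bs0 TP) expr0 scale1r subr0.
  rewrite addSn !yS.
  transitivity (q *: T h (y (n + k)%N - y n)); first by rewrite TB; lmodule R; ring.
  have nh0 : 0 <= n%:R * h by rewrite mulr_ge0 // ltW.
  rewrite IH TZ scalerA -exprS -(bsD TP) ?(ltW h0) //.
  by rewrite -natr1 mulrDl mul1r addrC.
have [p pP e e0|l lB yl] := @tau_complete _ _ _ _ XP y (M * nrm x) y_nrm.
  have ps := tau_seminorm XP pP; have [C C0 pC] := tau_dominated XP pP.
  have [N hN] := @geometric_small _ q (C * (M * nrm x)) (e / 2)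
    (ltac:(by rewrite ltW)) (ltac:(lra)).
  have hd k : p (y (N + k)%N - y N) <= e / 2.
    have qN : 0 <= q ^+ N by rewrite exprn_ge0 // ltW.
    rewrite yD (seminormZ ps) (ger0_norm qN).
    apply: le_trans hN; rewrite ler_wpM2l //.
    by apply: le_trans (pC _) _; rewrite ler_wpM2l // yB // mulr_ge0 // ltW.
  exists N => m n mN nN; have := hd (m - N)%N; have := hd (n - N)%N.
  rewrite !subnKC // => h1 h2.
  have := seminormB ps (y m - y N) (y n - y N).
  rewrite (_ : _ - _ = y m - y n); first by lra.
  by lmodule R; ring.
exists l; rewrite /abel_mean -/q.
apply/eqP; rewrite -subr_eq0; apply/eqP; apply: (tau_separated XP) => p pP.
have ps := tau_seminorm XP pP.
apply/eqP; rewrite eq_le seminorm_ge0 // andbT; apply/ler_addgt0Pr => e e0.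
have e2 : 0 < e / 2 by lra.
(* Equicontinuity on the bounded null sequence [y n - l] carries the recursion for [y] to its limit
   through [T h]. *)
have ul : tau_cvg P (fun n => y n - l) 0.
  by move=> p' p'P e' e'0; have [N hN] := yl p' p'P e' e'0;
     exists N => n nN; rewrite subr0; exact: hN.
have uB n : nrm (y n - l) <= M * nrm x + M * nrm x.
  by rewrite (le_trans (seminormB nrmP _ _)) // lerD.
have [N hN] := bs_equi TP uB ul pP (ltW h0) e2.
have [N' hN'] := yl p pP _ e2.
pose n := maxn N N'.
have h1 := hN n (leq_maxl _ _) h (ltac:(by rewrite ltW /=)).
have h2 := hN' n.+1 (leq_trans (leq_maxr _ _) (leqnSn _)).
rewrite add0r.
have -> : l - q *: T h l - (1 - q) *: x =
    q *: T h (y n - l) - (y n.+1 - l).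
  by rewrite yS TB; lmodule R; ring.
apply: le_trans (seminormB ps _ _) _; rewrite (seminormZ ps) gtr0_norm //.
have := seminorm_ge0 ps (T h (y n - l)); nra.
Qed.

End AbelMeans.
End BoundedSemigroup.

(** * The resolvent as a limit of Abel means *)

Section LaplaceLimit.
Context {R : realType} {V : lmodType R} (nrm : V -> R) (P : set (V -> R)).
Context (T : R -> {linear V -> V}) (M : R).
Hypothesis XP : two_topologies nrm P.
Hypothesis TP : bounded_semigroup nrm P T M.

Let nrmP := nrm_seminorm XP.

Let nrm_ge0 x : 0 <= nrm x.
Proof. exact: seminorm_ge0 nrmP x. Qed.

Let M_ge0 : 0 <= M.
Proof. by rewrite (le_trans _ (bs_ge1 TP)). Qed.

Let TB t x y : T t (x - y) = T t x - T t y.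
Proof. exact: linearB. Qed.

Context (lam : R) (lam0 : 0 < lam).

Lemma expRM_pow (h : R) n : expR (- (lam * (n%:R * h))) = expR (- (lam * h)) ^+ n.
Proof. by rewrite -expRM_natl; congr expR; ring. Qed.

(** Grouping N consecutive terms turns [y] into a mean of step N h whose datum is the weighted
    average of T(k h) x, k < N; [u] is its deviation from [x]. Means of different steps thus become
    means of one step with different data. The bound is [abel_mean_partial] with v = x, b = 0. *)
Lemma abel_mean_coarsen (h : R) x y N : 0 < h -> (0 < N)%N ->
  abel_mean T lam h x y ->
  exists2 u, abel_mean T lam (N%:R * h) (u + x) y &
    forall p a, seminorm p -> (forall k, (k < N)%N -> p (T (k%:R * h) x - x) <= a) ->
      p u <= a.
Proof.
move=> h0 N0 H; have h'0 : 0 < N%:R * h by rewrite mulr_gt0 // ltr0n.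
have /andP[q0 q1] := abel_weight lam0 h'0.
set q := expR _ in q0 q1.
have q1' : 1 - q != 0 by rewrite subr_eq0 gt_eqF.
exists ((1 - q)^-1 *: (y - x - q *: (T (N%:R * h) y - x))).
  rewrite /abel_mean -/q scalerDr scalerA divff // scale1r.
  by lmodule R; ring.
move=> p a ps hk.
have := @abel_mean_partial _ _ _ _ _ _ TP lam lam0 p x x y a 0 h N ps h0 H.
rewrite -expRM_pow -/q !mul0r !addr0 => h1.
rewrite (seminormZ ps) gtr0_norm ?invr_gt0 ?subr_gt0 // mulrC.
rewrite ler_pdivrMr ?subr_gt0 //; apply: le_trans (h1 _) _.
  by move=> k kN; rewrite mul0r addr0 hk.
by rewrite mulrBr mulr1 mulrC.
Qed.

(** Each step is an integer multiple of every later one, as coarsening requires. *)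
Definition dyadic (m : nat) : R := 2^-1 ^+ m.

Lemma dyadic_gt0 m : 0 < dyadic m.
Proof. by rewrite exprn_gt0 // invr_gt0. Qed.

Lemma dyadic_small e : 0 < e -> exists N, forall m, (N <= m)%N -> dyadic m <= e.
Proof.
move=> e0; have [N hN] := @geometric_small R 2^-1 1 e (ltac:(lra)) e0.
exists N => m Nm; apply: le_trans hN; rewrite mulr1 /dyadic.
by rewrite ler_wiXn2l //; lra.
Qed.

Lemma dyadicD m k : (2 ^ k)%:R * dyadic (m + k) = dyadic m.
Proof.
by rewrite /dyadic exprD mulrCA natrX -exprMn divff ?expr1n ?mulr1 // pnatr_eq0.
Qed.

Definition laplace_limit (x S : V) :=
  exists2 y : nat -> V, forall m, abel_mean T lam (dyadic m) x (y m) &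
    tau_cvg P y S.

(** After coarsening, [y (m + k) - y m] is the mean of [u] with step [dyadic m]. Its datum averages
    differences T(r) x - x with r < d, so [abel_mean_small] gives the Cauchy property. *)
Lemma laplace_limit_exists x : exists S, laplace_limit x S.
Proof.
have /choice[y hy] : forall m, exists y, abel_mean T lam (dyadic m) x y.
  by move=> m; apply: (abel_mean_exists XP TP lam0); exact: dyadic_gt0.
suff [S _ hS] : exists2 S, nrm S <= M * nrm x & tau_cvg P y S by exists S, y.
apply: (tau_complete XP) => [m|p pP e e0].
  exact: (abel_mean_nrm XP TP lam0 (dyadic_gt0 m)).
have ps := tau_seminorm XP pP.
have e2 : 0 < e / 2 by lra.
have [t0 t00 ht0] := abel_mean_small XP TP lam0 (M * nrm x + nrm x) pP e2.
have [d d0 hd] := bs_unif_cvg0 XP TP x pP t00 e2.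
have [N hN] := dyadic_small (ltac:(lra) : 0 < d / 2).
suff H m k : (N <= m)%N -> p (y (m + k)%N - y m) <= e.
  exists N => m n mN nN; have [mn|nm] := leqP m n.
    by rewrite (seminorm_distC ps) -(subnKC mn) H.
  by rewrite -(subnKC (ltnW nm)) H.
move=> mN; have [|u] :=
  abel_mean_coarsen (dyadic_gt0 (m + k)) _ (hy (m + k)%N) (N := 2 ^ k).
  by rewrite expn_gt0.
rewrite dyadicD => hu up.
have small i : (i < 2 ^ k)%N -> 0 <= i%:R * dyadic (m + k) < d.
  move=> ik; rewrite mulr_ge0 ?(ltW (dyadic_gt0 _)) //=.
  apply: (@le_lt_trans _ _ (dyadic m)); last by have := hN m mN; lra.
  by rewrite -(dyadicD m k) ler_wpM2r ?(ltW (dyadic_gt0 _)) // ler_nat ltnW.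
have := abel_meanB hu (hy m); rewrite addrK => hw.
rewrite [e]splitr; apply: (ht0 _ _ _ (dyadic_gt0 m) _ _ hw).
  apply: up => // i ik; have /andP[i0 _] := small i ik.
  apply: le_trans (seminormB nrmP _ _) _; rewrite lerD2r.
  exact: (bs_bound TP).
(* The bound on [u] holds for every seminorm, in particular for [p] composed with [T s]. *)
move=> s st; apply: (up _ _ (seminorm_comp ps (T s))) => i ik /=.
by apply: hd => //; exact: small.
Qed.

Context (x S : V) (xS : laplace_limit x S).

Lemma laplace_limit_mean p v a b : lsc_seminorm nrm P p -> 0 <= a -> 0 <= b ->
  (forall s, 0 <= s -> p (T s x - v) <= a + b * s) -> p (S - v) <= a + b / lam.
Proof.
move=> [ps pC plsc] a0 b0 hs; have [y hy yS] := xS.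
apply: (plsc (fun m => y m - v) (M * nrm x + nrm v)) => [m||m].
- apply: le_trans (seminormB nrmP _ _) _; rewrite lerD2r.
  exact: (abel_mean_nrm XP TP lam0 (dyadic_gt0 m)).
- move=> p' p'P e e0; have [N hN] := yS p' p'P e e0; exists N => n nN.
  rewrite (_ : _ - _ = y n - S) ?hN //.
  by lmodule R; ring.
- exact: (abel_mean_le TP lam0 ps pC (dyadic_gt0 m) a0 b0 (hy m) hs).
Qed.

(** The vector on the left is lam times the integral of e^(-lam s) (T(s) x - v) over [0, t], so
    times beyond t do not enter the estimate. *)
Lemma laplace_limit_partial p v t a : lsc_seminorm nrm P p -> 0 <= t ->
  (forall s, 0 <= s <= t -> p (T s x - v) <= a) ->
  p (S - v - expR (- (lam * t)) *: (T t S - v)) <= (1 - expR (- (lam * t))) * a.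
Proof.
move=> [ps pC plsc] t0 hs; have [y hy yS] := xS.
have a0 : 0 <= a.
  by apply: le_trans (hs 0 _); [exact: seminorm_ge0|rewrite lexx].
(* [t] need not be a multiple of the step; [tn m] is the largest multiple not exceeding it, and the
   discrete estimate at [tn m] is then passed to the limit. *)
pose n m := Num.truncn (t / dyadic m).
pose tn m := (n m)%:R * dyadic m.
have tn_ge0 m : 0 <= tn m by rewrite mulr_ge0 // ltW // dyadic_gt0.
have tnP m : tn m <= t < tn m + dyadic m.
  have /truncn_itv/andP[h1 h2] : 0 <= t / dyadic m.
    by rewrite divr_ge0 // ltW // dyadic_gt0.
  move: h1 h2; rewrite ler_pdivlMr ?dyadic_gt0 // => -> /=.
  by rewrite ltr_pdivrMr ?dyadic_gt0 // -natr1 mulrDl mul1r.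
pose E s := expR (- (lam * s)).
have E01 s : 0 <= s -> 0 <= E s <= 1.
  by move=> s0; rewrite expR_ge0 /= expR_le1 oppr_le0 mulr_ge0 // ltW.
have EE m : E t = E (tn m) * E (t - tn m).
  by rewrite /E -expRD; congr expR; ring.
have Ele m : 0 <= E (tn m) - E t <= lam * dyadic m.
  have /andP[tm tm'] := tnP m.
  have r0 : 0 <= t - tn m by rewrite subr_ge0.
  have /andP[h1 h2] := E01 _ r0; have /andP[h3 h4] := E01 _ (tn_ge0 m).
  have h5 := expR_mean_lb (mulr_ge0 (ltW lam0) r0); rewrite -/(E _) in h5.
  have h6 : lam * (t - tn m) <= lam * dyadic m by rewrite ler_pM2l //; lra.
  rewrite (EE m); apply/andP; split; nra.
have yB m : nrm (y m) <= M * nrm x.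
  exact: (abel_mean_nrm XP TP lam0 (dyadic_gt0 m)).
pose z m := y m - v - E (tn m) *: (T (tn m) (y m) - v).
pose B := M * nrm x + nrm v.
apply: (plsc z (B + (M * B + nrm v))) => [m||m].
- apply: le_trans (seminormB nrmP _ _) _; apply: lerD.
    by apply: le_trans (seminormB nrmP _ _) _; rewrite lerD2r.
  have /andP[h1 h2] := E01 _ (tn_ge0 m).
  rewrite (seminormZ nrmP) ger0_norm //.
  apply: (@le_trans _ _ (nrm (T (tn m) (y m) - v))); first by rewrite ler_piMl.
  apply: le_trans (seminormB nrmP _ _) _; rewrite lerD2r.
  apply: le_trans (bs_bound TP (tn_ge0 m) _) _; rewrite ler_wpM2l //.
  by rewrite (le_trans (yB m)) // lerDl.
- move=> p' p'P e e0; have ps' := tau_seminorm XP p'P.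
  pose D := lam * (p' (T t S) + p' v).
  have D0 : 0 <= D by rewrite mulr_ge0 ?(ltW lam0) // addr_ge0 // seminorm_ge0.
  have e4 : 0 < e / 4 by lra.
  have eD : 0 < e / 4 / (D + 1) by rewrite divr_gt0 //; lra.
  have [d d0 hd] := bs_unif_cvg0 XP TP S p'P t0 e4.
  have yS0 : tau_cvg P (fun m => y m - S) 0.
    move=> p1 p1P e1 e10; have [N hN] := yS p1 p1P e1 e10.
    by exists N => m mN; rewrite subr0 hN.
  have ySB m : nrm (y m - S) <= M * nrm x + nrm S.
    by apply: le_trans (seminormB nrmP _ _) _; rewrite lerD2r.
  have [N1 hN1] := yS p' p'P _ e4.
  have [N2 hN2] := bs_equi TP ySB yS0 p'P t0 e4.
  have [N3 hN3] := dyadic_small eD.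
  have [N4 hN4] := dyadic_small (ltac:(lra) : 0 < d / 2).
  exists (maxn (maxn N1 N2) (maxn N3 N4)) => m.
  rewrite !geq_max => /andP[/andP[m1 m2] /andP[m3 m4]].
  have /andP[tm tm'] := tnP m.
  (* The error splits into convergence of [y m] (directly and under [T (tn m)]), the orbit of [S]
     between [tn m] and [t], and the change of the exponential weight: four quarters of [e]. *)
  have -> : z m - (S - v - E t *: (T t S - v)) =
      (y m - S) - E (tn m) *: T (tn m) (y m - S)
      + E (tn m) *: T (tn m) (T (t - tn m) S - S)
      + (- (E (tn m) - E t)) *: (T t S - v).
    have TtE : T (tn m) (T (t - tn m) S) = T t S.
      by rewrite -(bsD TP) ?subr_ge0 // subrKC.
    rewrite /z !TB TtE.
    by lmodule R; ring.
  have h1 := hN1 m m1.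
  have h2 := hN2 m m2 (tn m) (ltac:(by rewrite tn_ge0)).
  have h3 : p' (T (tn m) (T (t - tn m) S - S)) <= e / 4.
    apply: hd; last by rewrite tn_ge0.
    by rewrite subr_ge0 tm /=; have := hN4 m m4; lra.
  have h4 : lam * dyadic m * (p' (T t S) + p' v) <= e / 4.
    rewrite mulrAC -/D mulrC.
    have := hN3 m m3; rewrite ler_pdivlMr; last by lra.
    have := dyadic_gt0 m; nra.
  have /andP[E0 E1] := E01 _ (tn_ge0 m); have /andP[h5 h6] := Ele m.
  have h7 := seminormB ps' (T t S) v.
  have g := seminorm_ge0 ps'.
  apply: le_trans (seminormD ps' _ _) _.
  have := seminormD ps' (y m - S - E (tn m) *: T (tn m) (y m - S))
    (E (tn m) *: T (tn m) (T (t - tn m) S - S)).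
  have := seminormB ps' (y m - S) (E (tn m) *: T (tn m) (y m - S)).
  rewrite !(seminormZ ps') !normrN (ger0_norm E0) (ger0_norm h5) => k1 k2.
  have k3 : E (tn m) * p' (T (tn m) (y m - S)) <= e / 4.
    by rewrite (le_trans _ h2) // ler_piMl.
  have k4 : E (tn m) * p' (T (tn m) (T (t - tn m) S - S)) <= e / 4.
    by rewrite (le_trans _ h3) // ler_piMl.
  have k5 : (E (tn m) - E t) * p' (T t S - v) <= e / 4.
    by rewrite (le_trans _ h4) // ler_pM.
  lra.
- have := @abel_mean_partial _ _ _ _ _ _ TP lam lam0 p v x (y m) a 0 _ (n m) ps
    (dyadic_gt0 m) (hy m).
  rewrite -expRM_pow !mul0r !addr0 -/(tn m) -/(E _) -/(E _) => h1.
  apply: le_trans (h1 _) _.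
    move=> k kn; rewrite mul0r addr0 hs //.
    rewrite mulr_ge0 ?(ltW (dyadic_gt0 _)) //=.
    have /andP[tm _] := tnP m; apply: le_trans tm.
    by rewrite ler_wpM2r ?(ltW (dyadic_gt0 _)) // ler_nat ltnW.
  rewrite mulrBl mul1r lerD2l lerN2 ler_wpM2r //.
  by have /andP[h2 _] := Ele m; rewrite -subr_ge0.
Qed.

End LaplaceLimit.

(** * The generator *)

Section Generator.
Context {R : realType} {V : lmodType R} (nrm : V -> R) (P : set (V -> R)).
Context (T : R -> {linear V -> V}) (M : R).
Hypothesis XP : two_topologies nrm P.
Hypothesis TP : bounded_semigroup nrm P T M.

Let nrmP := nrm_seminorm XP.

Let nrm_ge0 x : 0 <= nrm x.
Proof. exact: seminorm_ge0 nrmP x. Qed.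

Let M_ge0 : 0 <= M.
Proof. by rewrite (le_trans _ (bs_ge1 TP)). Qed.

Let TB t x y : T t (x - y) = T t x - T t y.
Proof. exact: linearB. Qed.

Let TZ t a x : T t (a *: x) = a *: T t x.
Proof. exact: linearZZ. Qed.

Definition slope (x : V) (t : R) : V := t^-1 *: (T t x - x).

Definition bounded_slope (x : V) :=
  exists B, forall t, 0 < t <= 1 -> nrm (slope x t) <= B.

Definition is_generator (x z : V) := tau_cvg0 P (slope x) z /\ bounded_slope x.

Lemma slopeZ a x t : slope (a *: x) t = a *: slope x t.
Proof. by rewrite /slope TZ; lmodule R; ring. Qed.

Lemma slopeB x y t : slope (x - y) t = slope x t - slope y t.
Proof. by rewrite /slope TB; lmodule R; ring. Qed.

Lemma is_generatorZ a x z : is_generator x z -> is_generator (a *: x) (a *: z).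
Proof.
move=> [xz [B xB]]; split.
  move=> p pP e e0; have ps := tau_seminorm XP pP.
  have ea : 0 < e / (`|a| + 1) by rewrite divr_gt0 // ltr_wpDl.
  have [d d0 hd] := xz p pP _ ea; exists d => // r rd.
  rewrite slopeZ -scalerBr (seminormZ ps).
  have := hd r rd; rewrite ler_pdivlMr ?ltr_wpDl // => h.
  have := seminorm_ge0 ps (slope x r - z); lra.
exists (`|a| * B) => t t01; rewrite slopeZ (seminormZ nrmP) ler_wpM2l //.
exact: xB.
Qed.

Lemma is_generatorB x y z w : is_generator x z -> is_generator y w ->
  is_generator (x - y) (z - w).
Proof.
move=> [xz [B xB]] [yw [B' yB]]; split.
  move=> p pP e e0; have ps := tau_seminorm XP pP.
  have e2 : 0 < e / 2 by lra.
  have [d d0 hd] := xz p pP _ e2; have [d' d'0 hd'] := yw p pP _ e2.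
  exists (Num.min d d'); first by rewrite lt_min d0.
  move=> r /andP[r0]; rewrite lt_min => /andP[rd rd'].
  have := hd r (ltac:(by rewrite r0)); have := hd' r (ltac:(by rewrite r0)).
  have := seminormB ps (slope x r - z) (slope y r - w).
  rewrite (_ : _ - _ - (_ - _) = slope (x - y) r - (z - w)).
    by move=> h1 h2 h3; lra.
  by rewrite slopeB; lmodule R; ring.
exists (B + B') => t t01; rewrite slopeB.
by apply: le_trans (seminormB nrmP _ _) _; rewrite lerD ?xB ?yB.
Qed.

Lemma seminorm_sum p (F : nat -> V) a N : seminorm p ->
  (forall k, (k < N)%N -> p (F k) <= a) -> p (\sum_(k < N) F k) <= N%:R * a.
Proof.
move=> ps; elim: N => [_|N IH hF]; first by rewrite big_ord0 seminorm0 // mul0r.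
rewrite big_ord_recr /= -natr1 mulrDl mul1r.
apply: le_trans (seminormD ps _ _) _; apply: lerD; last exact: hF.
by apply: IH => k kN; apply: hF; exact: leqW.
Qed.

(* [T t y - y] is the limit of the Riemann sums of [\int_0^t T(s) z ds]. *)
Lemma generator_mean_value y z p t a : is_generator y z ->
  lsc_seminorm nrm P p -> 0 < t -> (forall s, 0 <= s <= t -> p (T s z) <= a) ->
  p (T t y - y) <= t * a.
Proof.
move=> [yz [B yB]] [ps pC plsc] t0 hs.
pose h n : R := t / n.+1%:R.
have h0 n : 0 < h n by rewrite divr_gt0.
have nh n : n.+1%:R * h n = t by rewrite /h mulrC divfK // pnatr_eq0.
have kh n k : (k < n.+1)%N -> 0 <= k%:R * h n <= t.
  move=> kn; rewrite mulr_ge0 // ?(ltW (h0 n)) //= -[leRHS](nh n).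
  by rewrite ler_wpM2r ?(ltW (h0 n)) // ler_nat ltnW.
pose g n := \sum_(k < n.+1) h n *: T (k%:R * h n) z.
have gp (p' : V -> R) b n : seminorm p' ->
    (forall s, 0 <= s <= t -> p' (T s z) <= b) -> p' (g n) <= t * b.
  move=> ps' hb; apply: le_trans
      (@seminorm_sum p' (fun k => h n *: T (k%:R * h n) z) (h n * b) _ ps' _) _.
    move=> k kn; rewrite (seminormZ ps') gtr0_norm // ler_pM2l //.
    by apply: hb; exact: kh.
  by rewrite mulrA nh.
apply: (plsc g (t * (M * nrm z))) => [n||n]; last exact: gp.
  by apply: gp => // s /andP[s0 _]; exact: (bs_bound TP).
have D0 : tau_cvg0 P (fun r => slope y r - z) 0.
  by move=> p' p'P e e0; have [d d0 hd] := yz p' p'P e e0;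
     exists d => // r rd; rewrite subr0; exact: hd.
have DB r : 0 < r <= 1 -> nrm (slope y r - z) <= B + nrm z.
  move=> r01; apply: le_trans (seminormB nrmP _ _) _; rewrite lerD2r.
  exact: yB.
move=> p' p'P e e0; have ps' := tau_seminorm XP p'P.
have et : 0 < e / t by rewrite divr_gt0.
have [d d0 hd] := tau_cvg0_equi TP DB D0 p'P (ltW t0) et.
have dt : 0 < d / t by rewrite divr_gt0.
have [N _ hN] := near_infty_natSinv_lt (PosNum dt).
exists N => n nN; rewrite (seminorm_distC ps').
have hnd : h n < d.
  by have := hN n nN; rewrite /= ltr_pdivlMr // mulrC.
(* The increment of the orbit telescopes, and each piece is h T(k h) applied to the slope of [y];
   against the Riemann sum only slope minus [z] survives, which is small uniformly under T(k h). *)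
have -> : T t y - y - g n =
    \sum_(k < n.+1) h n *: T (k%:R * h n) (slope y (h n) - z).
  have -> : T t y - y =
      \sum_(k < n.+1) (T (k.+1%:R * h n) y - T (k%:R * h n) y).
    rewrite -(big_mkord xpredT (fun k => T (k.+1%:R * h n) y - T (k%:R * h n) y)).
    by rewrite telescope_sumr // nh mul0r (bs0 TP).
  rewrite /g -sumrB; apply: eq_bigr => k _.
  have k0 : 0 <= k%:R * h n by rewrite mulr_ge0 // ltW.
  have -> : k.+1%:R * h n = k%:R * h n + h n by rewrite -natr1 mulrDl mul1r.
  rewrite (bsD TP) ?(ltW (h0 n)) // TB TZ TB.
  by lmodule R; field; rewrite ?gt_eqF.
apply: le_trans (@seminorm_sum p'
    (fun k => h n *: T (k%:R * h n) (slope y (h n) - z)) (h n * (e / t)) _ ps' _) _.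
  move=> k kn; rewrite (seminormZ ps') gtr0_norm // ler_pM2l //.
  by apply: hd; [rewrite h0|exact: kh].
by rewrite mulrA nh mulrC divfK // gt_eqF.
Qed.

Context (lam : R) (lam0 : 0 < lam).

(** For each h, [y] is the Abel mean of step h of [u h] below. As h -> 0, [u h] stays bounded and
    tends to y - lam^-1 (lam y) = 0, so by uniformity in h its mean [y] is arbitrarily small. *)
Lemma generator_eigen0 y : is_generator y (lam *: y) -> y = 0.
Proof.
move=> [yl [B yB]]; apply: (tau_separated XP) => p pP.
have ps := tau_seminorm XP pP.
apply/eqP; rewrite eq_le seminorm_ge0 // andbT; apply/ler_addgt0Pr => e e0.
rewrite add0r.
have e2 : 0 < e / 2 by lra.
pose q h := expR (- (lam * h)).
pose u h := y - (q h / (1 - q h)) *: (T h y - y).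
(* This is h q / (1 - q), the factor of the slope in [u h]; it tends to lam^-1 as h -> 0. *)
pose c h := lam^-1 * (lam * h * q h / (1 - q h)).
have cP h : 0 < h -> 1 - lam * h <= lam * c h <= 1.
  move=> h0; have /andP[q0 q1] := abel_weight lam0 h0.
  have lh : 0 < lam * h by rewrite mulr_gt0.
  have := expR_mean_ub lh; have := expR_mean_lb (ltW lh); rewrite -/(q h) => h1 h2.
  rewrite /c mulrA divff ?gt_eqF // mul1r ler_pdivlMr ?subr_gt0 //.
  rewrite ler_pdivrMr ?subr_gt0 // mul1r h2 andbT.
  rewrite -/(q h) in q0 q1; nra.
have uE h : 0 < h -> u h = (1 - lam * c h) *: y - c h *: (slope y h - lam *: y).
  move=> h0; have /andP[_ q1] := abel_weight lam0 h0.
  rewrite /u /c /slope; lmodule R; field; rewrite !gt_eqF // subr_gt0 //.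
have up h p' : 0 < h -> seminorm p' ->
    p' (u h) <= lam * h * p' y + lam^-1 * p' (slope y h - lam *: y).
  move=> h0 ps'; have /andP[c1 c2] := cP h h0.
  have c0 : 0 <= c h.
    have /andP[q0 q1] := abel_weight lam0 h0.
    by rewrite mulr_ge0 ?invr_ge0 ?(ltW lam0) // !mulr_ge0 ?invr_ge0 ?subr_ge0 ?ltW.
  rewrite (uE h h0); apply: le_trans (seminormB ps' _ _) _.
  rewrite !(seminormZ ps') ger0_norm ?subr_ge0 // (ger0_norm c0); apply: lerD.
    by rewrite ler_wpM2r ?seminorm_ge0 //; lra.
  by rewrite ler_wpM2r ?seminorm_ge0 // -(ler_pM2l lam0) divff ?gt_eqF.
have uB r : 0 < r <= 1 -> nrm (u r) <= lam * nrm y + lam^-1 * (B + lam * nrm y).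
  move=> /andP[r0 r1]; apply: le_trans (up r nrm r0 nrmP) _; apply: lerD.
    by rewrite ler_wpM2r // ler_piMr // ltW.
  rewrite ler_wpM2l ?invr_ge0 ?(ltW lam0) //.
  apply: le_trans (seminormB nrmP _ _) _; apply: lerD.
    by apply: yB; rewrite r0.
  by rewrite (seminormZ nrmP) gtr0_norm.
have u0 : tau_cvg0 P u 0.
  move=> p' p'P e' e'0; have ps' := tau_seminorm XP p'P.
  have g := seminorm_ge0 ps' y.
  have e1 : 0 < lam * (e' / 2) by rewrite mulr_gt0 //; lra.
  have [d d0 hd] := yl p' p'P _ e1.
  pose d' := e' / 2 / (lam * (p' y + 1)).
  have l1 : 0 < lam * (p' y + 1) by rewrite mulr_gt0 // ltr_wpDl.
  have d'0 : 0 < d' by rewrite divr_gt0 //; lra.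
  exists (Num.min d d'); first by rewrite lt_min d0.
  move=> r /andP[r0]; rewrite lt_min => /andP[rd rd'].
  rewrite subr0; apply: le_trans (up r p' r0 ps') _.
  have h1 := hd r (ltac:(by rewrite r0)).
  have h2 : lam^-1 * p' (slope y r - lam *: y) <= e' / 2.
    by rewrite -(ler_pM2l lam0) mulrA divff ?gt_eqF // mul1r.
  have h3 : lam * r * p' y <= e' / 2.
    by move: rd'; rewrite ltr_pdivlMr // => h3; have := mulr_gt0 lam0 r0; nra.
  lra.
have [t0 t00 ht0] := abel_mean_small XP TP lam0
  (lam * nrm y + lam^-1 * (B + lam * nrm y)) pP e2.
have [d d0 hd] := tau_cvg0_equi TP uB u0 pP t00 e2.
pose h := Num.min (d / 2) 1.
have h0 : 0 < h by rewrite lt_min ltr01 andbT; lra.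
have h1 : h <= 1 by rewrite ge_min lexx orbT.
have hd' : h < d by rewrite gt_min; apply/orP; left; lra.
rewrite [e]splitr; apply: (ht0 h (u h) y h0).
- by apply: uB; rewrite h0.
- by apply: hd; rewrite h0.
- have /andP[_ q1] := abel_weight lam0 h0.
  rewrite /abel_mean /u /q.
  by lmodule R; field; rewrite subr_eq0 gt_eqF.
Qed.

(** The quotient is (e^(lam t) - 1) / t, the factor that appears when the partial Laplace formula is
    solved for the slope of S; it tends to lam. *)
Lemma laplace_weight t : 0 < t ->
  lam <= (1 - expR (- (lam * t))) / (expR (- (lam * t)) * t) <= lam * expR (lam * t).
Proof.
move=> t0; set q := expR _; have q0 : 0 < q := expR_gt0 _.
have lt0 : 0 < lam * t by rewrite mulr_gt0.
have := expR_mean_ub lt0; have := expR_mean_lb (ltW lt0); rewrite -/q => h1 h2.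
rewrite ler_pdivlMr ?mulr_gt0 // ler_pdivrMr ?mulr_gt0 //.
have qq : expR (lam * t) * q = 1 by rewrite expRxMexpNx_1.
have -> : lam * expR (lam * t) * (q * t) = lam * t * (expR (lam * t) * q) by ring.
by rewrite qq mulr1 h1 andbT; lra.
Qed.

(** The partial Laplace formula is solved for the slope of [S]. The choice v = x makes the remainder
    small and leaves the limit lam (S - x); the choice v = 0, in the norm, bounds the slopes. *)
Lemma laplace_limit_generator x S : laplace_limit P T lam x S ->
  is_generator S (lam *: (S - x)).
Proof.
move=> xS.
have slopeE v t : 0 < t -> slope S t =
    - ((expR (- (lam * t)) * t)^-1 *:
      (S - v - expR (- (lam * t)) *: (T t S - v)))
    + ((1 - expR (- (lam * t))) / (expR (- (lam * t)) * t)) *: (S - v).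
  move=> t0; have q0 : expR (- (lam * t)) != 0 by rewrite gt_eqF // expR_gt0.
  by rewrite /slope; lmodule R; field; rewrite q0 gt_eqF.
have weightE p v b t : seminorm p -> 0 < t ->
    p (S - v - expR (- (lam * t)) *: (T t S - v)) <= (1 - expR (- (lam * t))) * b ->
    p ((expR (- (lam * t)) * t)^-1 *: (S - v - expR (- (lam * t)) *: (T t S - v)))
    <= (1 - expR (- (lam * t))) / (expR (- (lam * t)) * t) * b.
  move=> ps t0 h; have qt : 0 < expR (- (lam * t)) * t by rewrite mulr_gt0 // expR_gt0.
  rewrite (seminormZ ps) gtr0_norm ?invr_gt0 //.
  by rewrite mulrAC mulrC ler_pM2r ?invr_gt0.
split=> [p pP e e0|].
  have ps := tau_seminorm XP pP; set w := p (S - x).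
  have w0 : 0 <= w := seminorm_ge0 ps _.
  have e1 : 0 < e / (4 * lam) by rewrite divr_gt0 // mulr_gt0.
  have [d d0 hd] := bs_unif_cvg0 XP TP x pP (lexx 0) e1.
  (* [d1] forces lam t <= 1/2, hence [kap <= 2 * lam]; [d2] makes (kap - lam) w <= 2 lam^2 t w at
     most e / 2. *)
  pose d1 := (2 * lam)^-1; pose d2 := e / (4 * lam ^+ 2 * (w + 1)).
  have d10 : 0 < d1 by rewrite invr_gt0 mulr_gt0.
  have l2 : 0 < 4 * lam ^+ 2 * (w + 1) by rewrite mulr_gt0 ?mulr_gt0 ?exprn_gt0 ?ltr_wpDl.
  have d20 : 0 < d2 by rewrite divr_gt0.
  exists (Num.min d (Num.min d1 d2)); first by rewrite !lt_min d0 d10.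
  move=> t /andP[t0]; rewrite !lt_min => /and3P[td td1 td2].
  have h1 : lam * t <= 1 / 2.
    move: td1; rewrite /d1 -[in X in X -> _](ltr_pM2l (mulr_gt0 (ltr0Sn R 1) lam0)).
    by rewrite divff ?mulf_neq0 ?gt_eqF // => h; lra.
  have /andP[k1 k2] := laplace_weight t0.
  (* With u = lam t <= 1/2: (1 - u) e^u <= 1 <= (1 - u) (1 + 2 u). *)
  have k3 : expR (lam * t) <= 1 + 2 * (lam * t).
    have := expR_ge1Dx (- (lam * t)); have := expRxMexpNx_1 (lam * t).
    have := expR_gt0 (lam * t); have := mulr_gt0 lam0 t0 => a1 a2 a3 a4.
    have a5 : 0 < 1 - lam * t by lra.
    rewrite -(ler_pM2r a5); apply: (@le_trans _ _ 1); last by nra.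
    by rewrite -[leRHS]a3 ler_pM2l.
  have hx s : 0 <= s <= t -> p (T s x - x) <= e / (4 * lam).
    move=> /andP[s0 st]; rewrite -[_ - _](bs0 TP).
    by apply: hd; [rewrite s0 (le_lt_trans st)|rewrite lexx].
  have := weightE p x _ t ps t0
    (laplace_limit_partial XP TP lam0 xS (lsc_tau XP pP) (ltW t0) hx).
  rewrite (slopeE x t t0).
  set kap := (1 - expR _) / _ in k1 k2 *; move=> h2.
  set A := _ *: (S - x - _) in h2 *.
  have -> : - A + kap *: (S - x) - lam *: (S - x) = (kap - lam) *: (S - x) - A.
    by lmodule R; ring.
  apply: le_trans (seminormB ps _ _) _.
  rewrite (seminormZ ps) ger0_norm ?subr_ge0 // -/w.
  have h3 : kap - lam <= 2 * lam ^+ 2 * t.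
    have : lam * expR (lam * t) <= lam * (1 + 2 * (lam * t)) by rewrite ler_pM2l.
    rewrite expr2; lra.
  have h4 : (kap - lam) * w <= 2 * lam ^+ 2 * t * w by rewrite ler_wpM2r.
  have h5 : kap <= 2 * lam.
    have : lam * expR (lam * t) <= lam * (1 + 2 * (lam * t)) by rewrite ler_pM2l.
    by have := ler_wpM2l (ltW lam0) h1 => a1 a2; lra.
  have h6 : kap * (e / (4 * lam)) <= 2 * lam * (e / (4 * lam)).
    by rewrite ler_wpM2r // ltW.
  have h7 : 2 * lam * (e / (4 * lam)) = e / 2 by field; rewrite gt_eqF.
  have h8 : 2 * lam ^+ 2 * t * w <= e / 2.
    move: td2; rewrite ltr_pdivlMr //.
    have : 0 <= lam ^+ 2 * t by rewrite mulr_ge0 ?exprn_ge0 ?ltW.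
    nra.
  lra.
exists (lam * expR lam * (M * nrm x + nrm S)) => t /andP[t0 t1].
have hx s : 0 <= s <= t -> nrm (T s x - 0) <= M * nrm x.
  by move=> /andP[s0 _]; rewrite subr0 (bs_bound TP).
have := weightE nrm 0 _ t nrmP t0
  (laplace_limit_partial XP TP lam0 xS (lsc_nrm XP) (ltW t0) hx).
have /andP[k1 k2] := laplace_weight t0.
rewrite (slopeE 0 t t0).
set kap := (1 - expR _) / _ in k1 k2 *; set A := _ *: (S - 0 - _); move=> h1.
apply: le_trans (seminormD nrmP _ _) _; rewrite (seminormN nrmP).
have kap0 : 0 <= kap by rewrite (le_trans (ltW lam0)).
rewrite (seminormZ nrmP kap) ger0_norm // subr0.
apply: (@le_trans _ _ (kap * (M * nrm x + nrm S))).
  by rewrite mulrDr lerD2r.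
rewrite ler_wpM2r ?addr_ge0 ?mulr_ge0 // (le_trans k2) // ler_pM2l // ler_expR.
by rewrite ler_piMr // ltW.
Qed.

End Generator.

(** * Hoelder spaces *)

Section PowerBounds.
Context {R : realType} (al : R) (al01 : 0 < al < 1).

Lemma powR_le_id (u : R) : 1 <= u -> u `^ al <= u.
Proof.
move=> u1; have /andP[_ /ltW al1] := al01.
by rewrite -[leRHS]powRr1 ?(le_trans _ u1) // ler_powR.
Qed.

(** Comes from (mu s)^al <= max(1, mu s). *)
Lemma powR_le_affine (mu s : R) : 0 < mu -> 0 <= s ->
  s `^ al <= (mu `^ al)^-1 * (1 + mu * s).
Proof.
move=> mu0 s0; have ms : 0 <= mu * s by rewrite mulr_ge0 // ltW.
rewrite ler_pdivlMl ?powR_gt0 // -powRM ?(ltW mu0) //.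
have [u1|/ltW u1] := leP (mu * s) 1; last first.
  by apply: le_trans (powR_le_id u1) _; rewrite lerDr.
apply: (@le_trans _ _ 1); last by rewrite lerDl.
have /andP[al0 _] := al01.
have <- : 1 `^ al = 1 :> R by rewrite powR1.
by rewrite ge0_ler_powR ?nnegrE // ltW.
Qed.

Lemma powR_le_linear (d s : R) : 0 < d -> d <= s -> s `^ al <= d `^ al / d * s.
Proof.
move=> d0 ds; have sd : 1 <= s / d by rewrite ler_pdivlMr // mul1r.
have -> : d `^ al / d * s = d `^ al * (s / d) by rewrite mulrAC mulrA.
have -> : s `^ al = d `^ al * (s / d) `^ al.
  rewrite -powRM ?(ltW d0) ?(le_trans _ sd) //.
  by rewrite mulrC divfK // gt_eqF.
by rewrite ler_pM2l ?powR_gt0 // powR_le_id.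
Qed.

Lemma powR_inv (x : R) : 0 <= x -> x^-1 `^ al = (x `^ al)^-1.
Proof. by move=> x0; rewrite -powR_inv1 // -powRrM mulN1r powRN. Qed.

Lemma powR_div_small (e : R) : 0 < e ->
  exists2 L, 0 < L & forall lam, L < lam -> lam `^ al / lam <= e.
Proof.
move=> e0; have /andP[al0 al1] := al01; pose be := 1 - al.
have be0 : 0 < be by rewrite subr_gt0.
(* The solution L of L^(al - 1) = e. *)
exists (e^-1 `^ be^-1); first by rewrite powR_gt0 // invr_gt0.
move=> lam h; have lam0 : 0 < lam by rewrite (le_lt_trans _ h) // powR_ge0.
have : e^-1 <= lam `^ be.
  have -> : e^-1 = (e^-1 `^ be^-1) `^ be.
    by rewrite -powRrM mulVf ?gt_eqF // powRr1 // invr_ge0 ltW.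
  by rewrite ge0_ler_powR ?nnegrE ?powR_ge0 ?ltW.
rewrite -[X in _ <= X]invrK lef_pV2 ?posrE ?invr_gt0 ?powR_gt0 //.
rewrite -powRN opprB powRB ?powRr1 ?(ltW lam0) //.
by rewrite (lt_eqF al1).
Qed.

End PowerBounds.

(** * Hoelder quotients against scaled resolvents *)

Section FavardHoelder.
Context {R : realType} {V : lmodType R} (nrm : V -> R) (P : set (V -> R)).
Context (T : R -> {linear V -> V}) (M : R).
Hypothesis XP : two_topologies nrm P.
Hypothesis TP : bounded_semigroup nrm P T M.
Context (al : R) (al01 : 0 < al < 1).

Let nrmP := nrm_seminorm XP.

Let nrm_ge0 x : 0 <= nrm x.
Proof. exact: seminorm_ge0 nrmP x. Qed.

Let M_ge0 : 0 <= M.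
Proof. by rewrite (le_trans _ (bs_ge1 TP)). Qed.

(** Since A (S / lam) = S - x, the difference of the two solutions is an eigenvector for [lam],
    hence zero. *)
Lemma resolvent_unique lam x S y z : 0 < lam -> laplace_limit P T lam x S ->
  is_generator nrm P T y z -> lam *: y - z = x -> y = lam^-1 *: S.
Proof.
move=> lam0 xS yz yzx; apply/eqP; rewrite -subr_eq0; apply/eqP.
apply: (generator_eigen0 XP TP lam0).
have := is_generatorZ XP lam^-1 (laplace_limit_generator XP TP lam0 xS).
move/(is_generatorB XP yz); congr is_generator.
rewrite -yzx; lmodule R; field; rewrite gt_eqF //.
Qed.

Definition hoelder_quotient (x : V) (t : R) := (t `^ al)^-1 *: (T t x - x).

Context (x : V) (S : R -> V).
Hypothesis xS : forall lam, 0 < lam -> laplace_limit P T lam x (S lam).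

Definition scaled_resolvent (lam : R) := lam `^ al *: (S lam - x).

Lemma hoelder_quotient_le p b t : seminorm p -> 0 < t ->
  p (hoelder_quotient x t) <= b -> p (T t x - x) <= b * t `^ al.
Proof.
move=> ps t0; rewrite (seminormZ ps) gtr0_norm ?invr_gt0 ?powR_gt0 //.
by rewrite ler_pdivrMl ?powR_gt0 // mulrC.
Qed.

Lemma scaled_resolvent_bounded C :
  (forall t, 0 < t -> nrm (hoelder_quotient x t) <= C) ->
  forall lam, 0 < lam -> nrm (scaled_resolvent lam) <= C + C.
Proof.
move=> hC lam lam0.
have C0 : 0 <= C by apply: le_trans (hC 1 ltr01).
have la : 0 < lam `^ al by rewrite powR_gt0.
pose A := C * (lam `^ al)^-1.
have A0 : 0 <= A by rewrite mulr_ge0 // invr_ge0 ltW.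
have h : nrm (S lam - x) <= A + A * lam / lam.
  apply: (laplace_limit_mean XP TP lam0 (xS lam0) (lsc_nrm XP)) => //.
    by rewrite mulr_ge0 // ltW.
  move=> s; rewrite le_eqVlt => /predU1P[<-|s0].
    by rewrite (bs0 TP) subrr (seminorm0 nrmP) mulr0 addr0.
  apply: le_trans (hoelder_quotient_le nrmP s0 (hC s s0)) _.
  have := ler_wpM2l C0 (powR_le_affine al01 lam0 (ltW s0)).
  by rewrite /A; lra.
rewrite (seminormZ nrmP) gtr0_norm //.
apply: le_trans (ler_wpM2l (ltW la) h) _.
by rewrite /A mulfK ?gt_eqF // -mulrDl mulrCA divff ?mulr1 ?gt_eqF.
Qed.

(** The tau-limit controls times s < d only. Later times are handled by the norm bound through the
    linear majorant [D * s], whose contribution D lam^(al - 1) vanishes as lam grows. *)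
Lemma scaled_resolvent_cvg0 C :
  (forall t, 0 < t -> nrm (hoelder_quotient x t) <= C) ->
  tau_cvg0 P (hoelder_quotient x) 0 ->
  forall p, P p -> forall e, 0 < e ->
    exists2 L, 0 < L & forall lam, L < lam -> p (scaled_resolvent lam) <= e.
Proof.
move=> hC h0 p pP e e0; have ps := tau_seminorm XP pP.
have [K K0 pK] := tau_dominated XP pP.
have C0 : 0 <= C by apply: le_trans (hC 1 ltr01).
have e4 : 0 < e / 4 by lra.
have [d d0 hd] := h0 p pP _ e4.
pose D := K * C * (d `^ al / d).
have D0 : 0 <= D by rewrite !mulr_ge0 ?powR_ge0 // invr_ge0 ltW.
have eD : 0 < e / 4 / (D + 1) by rewrite divr_gt0 // ltr_wpDl.
have [L L0 hL] := powR_div_small al01 eD.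
exists L => // lam lamL; have lam0 : 0 < lam by apply: lt_trans lamL.
have la : 0 < lam `^ al by rewrite powR_gt0.
pose A := e / 4 * (lam `^ al)^-1.
have A0 : 0 <= A by rewrite mulr_ge0 ?ltW // invr_gt0.
have Al0 : 0 <= A * lam by rewrite mulr_ge0 // ltW.
have h : p (S lam - x) <= A + (A * lam + D) / lam.
  apply: (laplace_limit_mean XP TP lam0 (xS lam0) (lsc_tau XP pP)) => //.
    by rewrite addr_ge0.
  move=> s; rewrite le_eqVlt => /predU1P[<-|s0].
    by rewrite (bs0 TP) subrr (seminorm0 ps) mulr0 addr0.
  have [ds|sd] := leP d s.
    have h1 : p (T s x - x) <= K * (C * s `^ al).
      apply: le_trans (pK _) _; rewrite ler_wpM2l //.
      exact: (hoelder_quotient_le nrmP s0 (hC s s0)).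
    have h2 := ler_wpM2l (mulr_ge0 K0 C0) (powR_le_linear al01 d0 ds).
    have h3 := mulr_ge0 Al0 (ltW s0).
    by rewrite /D; lra.
  have := hd s (ltac:(by rewrite s0)); rewrite subr0.
  move/(hoelder_quotient_le ps s0) => h1.
  have h2 := ler_wpM2l (ltW e4) (powR_le_affine al01 lam0 (ltW s0)).
  have h3 := mulr_ge0 D0 (ltW s0).
  by rewrite /A; lra.
rewrite (seminormZ ps) gtr0_norm //.
apply: le_trans (ler_wpM2l (ltW la) h) _.
have -> : lam `^ al * (A + (A * lam + D) / lam) =
    e / 4 + e / 4 + D * (lam `^ al / lam).
  by rewrite /A; field; rewrite !gt_eqF.
have h1 : (D + 1) * (lam `^ al / lam) <= e / 4.
  by have := hL lam lamL; rewrite ler_pdivlMr ?ltr_wpDl // mulrC.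
have h2 : 0 <= lam `^ al / lam by rewrite divr_ge0 // ltW.
lra.
Qed.

(** The 3 counts one term for (T(t) y - y) / t with A y = z, and two for T(t) z - z. *)
Lemma hoelder_quotient_ub p b t : lsc_seminorm nrm P p -> 0 < t ->
  (forall s, 0 <= s <= t -> p (T s (scaled_resolvent t^-1)) <= b) ->
  p (hoelder_quotient x t) <= 3 * b.
Proof.
move=> pL t0 hb; have ps := lsc_seminormP pL.
have l0 : 0 < t^-1 by rewrite invr_gt0.
have ta : 0 < t `^ al by rewrite powR_gt0.
(* Here [y] is R(1/t, A) x, whence A y = z. *)
set S' := S t^-1; pose z := S' - x; pose y := t *: S'.
have hz s : 0 <= s <= t -> p (T s z) <= b * t `^ al.
  move=> st; have := hb s st.
  rewrite linearZZ (seminormZ ps) powR_inv ?(ltW t0) //.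
  by rewrite gtr0_norm ?invr_gt0 // ler_pdivrMl // mulrC.
have yz : is_generator nrm P T y z.
  have := is_generatorZ XP t (laplace_limit_generator XP TP l0 (xS l0)).
  by rewrite scalerA divff ?gt_eqF // scale1r.
have h1 := generator_mean_value XP TP yz pL t0 hz.
have h2 := hz t (ltac:(by rewrite lexx ltW)).
have h3 : p z <= b * t `^ al.
  by have := hz 0; rewrite (bs0 TP) lexx (ltW t0); apply.
rewrite /hoelder_quotient (seminormZ ps) gtr0_norm ?invr_gt0 //.
rewrite ler_pdivrMl // mulrC.
have -> : T t x - x = t^-1 *: (T t y - y) - (T t z - z).
  have -> : T t z = T t S' - T t x by exact: linearB.
  have -> : T t y = t *: T t S' by exact: linearZZ.
  rewrite /y /z.
  by lmodule R; field; rewrite gt_eqF.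
apply: le_trans (seminormB ps _ _) _.
have h4 : p (t^-1 *: (T t y - y)) <= b * t `^ al.
  by rewrite (seminormZ ps) gtr0_norm // ler_pdivrMl.
have h5 := seminormB ps (T t z) z; lra.
Qed.

Lemma hoelder_quotient_bounded C :
  (forall lam, 0 < lam -> nrm (scaled_resolvent lam) <= C) ->
  forall t, 0 < t -> nrm (hoelder_quotient x t) <= 3 * (M * C).
Proof.
move=> hC t t0; apply: (hoelder_quotient_ub (lsc_nrm XP) t0) => s /andP[s0 _].
apply: le_trans (bs_bound TP s0 _) _; rewrite ler_wpM2l //.
by apply: hC; rewrite invr_gt0.
Qed.

Lemma hoelder_quotient_cvg0 C :
  (forall lam, 0 < lam -> nrm (scaled_resolvent lam) <= C) ->
  (forall p, P p -> forall e, 0 < e ->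
    exists2 L, 0 < L & forall lam, L < lam -> p (scaled_resolvent lam) <= e) ->
  tau_cvg0 P (hoelder_quotient x) 0.
Proof.
move=> hC h0 p pP e e0.
have YC r : 0 < r <= 1 -> nrm (scaled_resolvent r^-1) <= C.
  by move=> /andP[r0 _]; apply: hC; rewrite invr_gt0.
have Y0 : tau_cvg0 P (fun r => scaled_resolvent r^-1) 0.
  move=> p' p'P e' e'0; have [L L0 hL] := h0 p' p'P e' e'0.
  exists L^-1; first by rewrite invr_gt0.
  move=> r /andP[r0 rL]; rewrite subr0; apply: hL.
  by rewrite -[L]invrK ltf_pV2 ?posrE ?invr_gt0.
have e3 : 0 < e / 3 by lra.
(* With t <= 1 imposed below, equicontinuity on [0, 1] covers all s <= t. *)
have [d d0 hd] := tau_cvg0_equi TP YC Y0 pP ler01 e3.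
exists (Num.min d 1); first by rewrite lt_min d0 ltr01.
move=> t /andP[t0]; rewrite lt_min => /andP[td t1]; rewrite subr0.
have -> : e = 3 * (e / 3) by field.
apply: (hoelder_quotient_ub (lsc_tau XP pP) t0) => s /andP[s0 st].
by apply: hd; [rewrite t0|rewrite s0 (le_trans st) // ltW].
Qed.

End FavardHoelder.

(** * Norm and topology as families of real seminorms *)

Section Gauge.
Context {R : realType} {V : lmodType R} (W : set V).
Hypothesis convexW : forall x y (s : R), 0 <= s <= 1 -> W x -> W y ->
  W (s *: x + (1 - s) *: y).
Hypothesis oppW : forall x, W x -> W (- x).
Hypothesis absorbingW : forall x, exists2 r : R, 0 < r & W (r^-1 *: x).

Let G x := [set r : R | 0 < r /\ W (r^-1 *: x)].

Definition gauge x := inf (G x).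

Let G_has_inf x : has_inf (G x).
Proof.
by split; [have [r r0 rx] := absorbingW x; exists r|exists 0 => r [/ltW]].
Qed.

Let gauge_ge0 x : 0 <= gauge x.
Proof. by apply: lb_le_inf; [have [] := G_has_inf x|move=> r [/ltW]]. Qed.

Lemma gauge_le x r : 0 < r -> W (r^-1 *: x) -> gauge x <= r.
Proof. by move=> r0 rx; apply: ge_inf; [have [] := G_has_inf x|]. Qed.

Lemma le_gauge x a : (forall r, 0 < r -> W (r^-1 *: x) -> a <= r) -> a <= gauge x.
Proof.
by move=> h; apply: lb_le_inf; [have [] := G_has_inf x|move=> r [r0]; exact: h].
Qed.

Lemma gauge_lt1 x : gauge x < 1 -> W x.
Proof.
move=> /(inf_lt (G_has_inf x).1)[r [r0 rx] r1].
have W0 : W 0.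
  move: rx; set y := _ *: x => rx.
  have := convexW (_ : 0 <= 2^-1 <= 1) rx (oppW rx).
  rewrite (_ : _ + _ = 0); first by apply; lra.
  by lmodule R; field.
have := convexW (_ : 0 <= r <= 1) rx W0.
rewrite scaler0 addr0 scalerA divff ?gt_eqF // scale1r; apply.
by rewrite !ltW.
Qed.

Lemma gauge_seminorm : seminorm gauge.
Proof.
have le_pos a x : 0 < a -> gauge (a *: x) <= a * gauge x.
  move=> a0; rewrite -ler_pdivrMl //; apply: le_gauge => r r0 rx.
  rewrite ler_pdivrMl //; apply: gauge_le; first exact: mulr_gt0.
  by rewrite scalerA invfM mulrAC mulVf ?mul1r // gt_eqF.
have pos a x : 0 < a -> gauge (a *: x) = a * gauge x.
  move=> a0; apply/eqP; rewrite eq_le le_pos //= -ler_pdivlMl //.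
  have := le_pos a^-1 (a *: x); rewrite scalerA mulVf ?gt_eqF // scale1r.
  by apply; rewrite invr_gt0.
have neg x : gauge (- x) = gauge x.
  suff h y : gauge (- y) <= gauge y by apply/eqP; rewrite eq_le h -{1}[x]opprK h.
  by apply: le_gauge => r r0 /oppW; rewrite -scalerN; exact: gauge_le.
split=> [x y|a x].
  rewrite -lerBlDr; apply: le_gauge => r r0 rx.
  rewrite lerBlDr -lerBlDl; apply: le_gauge => s s0 sy.
  rewrite lerBlDl; apply: gauge_le; first exact: addr_gt0.
  have rs : r + s != 0 by rewrite gt_eqF // addr_gt0.
  have := convexW (_ : 0 <= r / (r + s) <= 1) rx sy.
  rewrite (_ : _ + _ = (r + s)^-1 *: (x + y)).
    have rs0 : 0 < r + s by rewrite addr_gt0.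
    by apply; rewrite ltW ?divr_gt0 //= ler_pdivrMr // mul1r lerDl ltW.
  by lmodule R; field; rewrite rs !gt_eqF.
have [a0|a0|->] := ltrgt0P a; first exact: pos.
  by rewrite -neg -scaleNr pos // oppr_gt0.
rewrite scale0r mul0r; apply/eqP; rewrite eq_le gauge_ge0 andbT.
have := @le_pos 2^-1 0; rewrite scaler0 => h.
have := gauge_ge0 0; have := h (ltac:(lra)); lra.
Qed.

End Gauge.

(** * Restriction of scalars to the reals *)

Section RealPart.
Context {R : realType}.

Definition real_part (K : numFieldType) (k : real_or_complex R K) : K -> R :=
  match k in real_or_complex _ K return K -> R with
  | RealScalars => id
  | ComplexScalars => @complex.Re R
  end.

Context (K : numFieldType) (k : real_or_complex R K).
Implicit Types (a b : R) (z w : K).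

Lemma ofRD a b : ofR k (a + b) = ofR k a + ofR k b.
Proof. by case: K / k => //; exact: raddfD. Qed.

Lemma ofRM a b : ofR k (a * b) = ofR k a * ofR k b.
Proof. by case: K / k => //; exact: rmorphM. Qed.

Lemma ofR1 : ofR k 1 = 1.
Proof. by case: K / k. Qed.

Lemma ofR0 : ofR k 0 = 0.
Proof. by case: K / k. Qed.

Lemma ofRN a : ofR k (- a) = - ofR k a.
Proof. by case: K / k => //; exact: raddfN. Qed.

Lemma ofRV a : ofR k a^-1 = (ofR k a)^-1.
Proof. by case: K / k => //; exact: fmorphV. Qed.

Lemma ler_ofR a b : (ofR k a <= ofR k b) = (a <= b).
Proof. by case: K / k => //; exact: lecR. Qed.

Lemma ltr_ofR a b : (ofR k a < ofR k b) = (a < b).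
Proof. by case: K / k => //; exact: ltcR. Qed.

Lemma real_partK : cancel (ofR k) (real_part k).
Proof. by case: K / k. Qed.

Lemma ge0_real_part z : 0 <= z -> ofR k (real_part k z) = z.
Proof. by case: K / k z => //= z /ger0_real; exact: RRe_real. Qed.

Lemma ler_real_part z w : z <= w -> real_part k z <= real_part k w.
Proof. by case: K / k z w => //= z w; rewrite lecE => /andP[]. Qed.

Lemma normr_ofR a : `|ofR k a| = ofR k `|a|.
Proof.
case: K / k => //=; rewrite normc_def /= expr0n addr0 sqrtr_sqr //.
Qed.

End RealPart.

(** An alias, so that the real module structure does not compete with the one over [K] on the same
    carrier. *)
Definition realified {R : realType} {K : numFieldType} (k : real_or_complex R K)
  (X : lmodType K) : Type := X.

Section Realified.
Context {R : realType} {K : numFieldType} (k : real_or_complex R K) (X : lmodType K).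

HB.instance Definition _ := GRing.Zmodule.copy (realified k X) X.

Definition real_scale (a : R) (x : realified k X) : realified k X :=
  ofR k a *: (x : X).

Lemma real_scaleA a b x : real_scale a (real_scale b x) = real_scale (a * b) x.
Proof. by rewrite /real_scale scalerA ofRM. Qed.

Lemma real_scale1 : left_id 1 real_scale.
Proof. by move=> x; rewrite /real_scale ofR1 scale1r. Qed.

Lemma real_scaleDr : right_distributive real_scale +%R.
Proof. by move=> a x y; rewrite /real_scale scalerDr. Qed.

Lemma real_scaleDl x : {morph real_scale^~ x : a b / a + b}.
Proof. by move=> a b; rewrite /real_scale ofRD scalerDl. Qed.

HB.instance Definition _ := GRing.Zmodule_isLmodule.Build R (realified k X)
  real_scaleA real_scale1 real_scaleDr real_scaleDl.

Definition realified_fun (f : X -> X) : realified k X -> realified k X := f.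

Lemma realified_fun_linear (f : {linear X -> X}) : linear (realified_fun f).
Proof. by move=> a x y; rewrite /realified_fun linearD linearZZ. Qed.

HB.instance Definition _ (f : {linear X -> X}) :=
  GRing.isLinear.Build R (realified k X) (realified k X) *:%R
    (realified_fun f) (realified_fun_linear f).

Lemma realified_scaleE (a : R) (x : realified k X) : a *: x = ofR k a *: (x : X) :> X.
Proof. by []. Qed.

End Realified.

(** * From the triple to a norm and a family of seminorms *)

Section NormAndTau.
Context {R : realType} {K : numFieldType} (k : real_or_complex R K).
Context {X : completeNormedModType K} {Xtau : tvsType K} (j : {linear X -> Xtau}).

Local Notation V := (realified k X).

Definition real_norm (x : V) : R := real_part k `|x : X|.

Lemma ofR_norm x : ofR k (real_norm x) = `|x : X|.
Proof. exact: ge0_real_part. Qed.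

Lemma real_norm_seminorm : seminorm real_norm.
Proof.
split=> [x y|a x].
  by rewrite -(ler_ofR k) ofRD !ofR_norm ler_normD.
apply: (can_inj (real_partK k)); rewrite ofRM !ofR_norm -normr_ofR.
exact: normrZ.
Qed.

Lemma norm_le_ofR (x : X) (B : R) : (`|x| <= ofR k B) = (real_norm x <= B).
Proof. by rewrite -ofR_norm ler_ofR. Qed.

Lemma has_ubound_norm (I : Type) (A : set I) (f : I -> X) :
  has_ubound [set `|f i| | i in A] <->
  exists B, forall i, A i -> real_norm (f i) <= B.
Proof.
split=> [[b ub]|[B hB]].
  exists (real_part k b) => i Ai; apply: ler_real_part; apply: ub.
  by exists i.
by exists (ofR k B) => _ [i Ai <-]; rewrite norm_le_ofR hB.
Qed.

(** The tau-continuous real seminorms pulled back along [j]; for a seminorm, continuity amounts to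
    its balls being neighborhoods of 0. *)
Definition tau_seminorms : set (V -> R) := [set p : V -> R | seminorm p /\
  forall e, 0 < e -> nbhs (0 : Xtau) (j @` [set x : X | p x <= e])].

Hypothesis jS : assumption_S j.

Let j_inj : injective j := bij_inj (tau_bij jS).

Let j_surj (z : Xtau) : exists x, j x = z.
Proof. by have [g _ gK] := tau_bij jS; exists (g z). Qed.

Let jZ (a : R) (x : V) : j (a *: x) = ofR k a *: j x.
Proof. exact: linearZZ. Qed.

Let jD (x y : V) : j (x + y) = j x + j y.
Proof. exact: linearD. Qed.

Let jN (x : V) : j (- x) = - j x.
Proof. exact: linearN. Qed.

Let jB (x y : V) : j (x - y) = j x - j y.
Proof. exact: linearB. Qed.

Let ofRV_neq0 (a : R) : 0 < a -> ofR k a != 0.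
Proof. by move=> a0; rewrite gt_eqF // -(ofR0 k) ltr_ofR. Qed.

Lemma tau_seminorm_nbhs (U : set Xtau) : nbhs 0 U ->
  exists2 p : V -> R, tau_seminorms p & forall x : V, p x < 1 -> U (j x).
Proof.
move=> U0; have [B convB [openB baseB]] := @locally_convex K Xtau.
have [b [Bb b0] bU] := baseB 0 U U0.
have nb : nbhs 0 b by apply: open_nbhs_nbhs; split => //; exact: openB.
(* Local convexity supplies a convex set that need not be balanced; over real scalars, symmetrizing
   it is enough for its gauge to be a seminorm. *)
pose W : set V := [set x | b (j x) /\ b (- j x)].
have convb (x y : Xtau) (s : R) : 0 <= s <= 1 -> b x -> b y ->
    b (ofR k s *: x + ofR k (1 - s) *: y).
  move=> /andP[s0 s1] bx b_y.
  have t0 : 0 <= ofR k s by rewrite -(ofR0 k) ler_ofR.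
  have t1 : ofR k s <= 1 by rewrite -(ofR1 k) ler_ofR.
  have := convB b (mem_set Bb) x y (Itv01 t0 t1) (mem_set bx) (mem_set b_y).
  move/set_mem; congr b; congr (_ + _ *: _).
  by rewrite /= ofRD ofRN ofR1.
have convW (x y : V) (s : R) : 0 <= s <= 1 -> W x -> W y ->
    W (s *: x + (1 - s) *: y).
  move=> s01 [x1 x2] [y1 y2]; split; first by rewrite jD !jZ; exact: convb.
  by rewrite jD !jZ opprD -!scalerN; exact: convb.
have oppW (x : V) : W x -> W (- x) by move=> [x1 x2]; split; rewrite jN ?opprK.
have nW : nbhs (0 : Xtau) (b `&` (-%R @` b)).
  by apply: filterI => //; exact: nbhs0N.
have absW (x : V) : exists2 r : R, 0 < r & W (r^-1 *: x).
  (* Absorption is continuity of the scalar action at (0, j x): small multiples of j x fall into the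
     set. *)
  have [/= [A1 A2] [/= A10 A20] hA] :
      nbhs ((0 : K^o), j x) (fun z : K^o * Xtau => (b `&` (-%R @` b)) (z.1 *: z.2)).
    by apply: scale_continuous; rewrite /= scale0r.
  have [e /= e0 eA] := A10.
  have re0 : 0 < real_part k e.
    by rewrite -(ltr_ofR k) ofR0 ge0_real_part // ltW.
  exists (2 / real_part k e); first by rewrite divr_gt0.
  have [] := hA (ofR k (2 / real_part k e)^-1, j x).
    split; last exact: nbhs_singleton.
    apply: eA; rewrite /ball_ /= sub0r normrN normr_ofR invf_div.
    rewrite ger0_norm ?divr_ge0 ?(ltW re0) //.
    rewrite -[ltRHS](ge0_real_part k) ?(ltW e0) // ltr_ofR; lra.
  rewrite /= -jZ => h1 [z bz zE]; split=> //.
  by rewrite -zE opprK.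
exists (gauge W).
  split; first exact: gauge_seminorm.
  move=> e e0; have := nbhs0Z (ofRV_neq0 e0) nW; apply: filterS => z.
  move=> [y [b_y [y' b_y' y'E]] <-]; have [x xy] := j_surj y.
  exists (e *: (x : V)); last by rewrite -xy jZ.
  apply: (gauge_le absW e0); rewrite scalerA mulVf ?gt_eqF // scale1r.
  by split; rewrite xy // -y'E opprK.
by move=> x /(gauge_lt1 convW oppW absW)[/bU].
Qed.

Lemma tau_cvgP (I : Type) (F : set_system I) (f : I -> X) (l : X) : Filter F ->
  (j (f i) @[i --> F] --> j l) <->
  (forall p, tau_seminorms p -> forall e, 0 < e ->
     \forall i \near F, p (f i - l) <= e).
Proof.
move=> FF; split=> [fl p [ps pn] e e0|h U Ul].
  have : F [set i | (+%R (j l) @` (j @` [set x : X | p x <= e])) (j (f i))].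
    by apply: fl; apply: nbhsT; exact: pn.
  apply: filterS => i /= [_ [x px <-] zE].
  suff -> : f i - l = x by [].
  by apply: j_inj; rewrite -[LHS]/(j ((f i : V) - l)) jB -zE addrC addKr.
have U0 : nbhs 0 (+%R (- j l) @` U) by rewrite -(addNr (j l)); exact: nbhsB.
have [p pP pU] := tau_seminorm_nbhs U0.
rewrite /nbhs /=; have := h p pP 2^-1 (ltac:(lra)); apply: filterS => i /= hi.
have [|u Uu uE] := pU (f i - l); first by rewrite (le_lt_trans hi) //; lra.
suff -> : j (f i) = u by [].
by move: uE; rewrite -[RHS]/(j ((f i : V) - l)) jB addrC => /addIr ->.
Qed.

Lemma tau_cvg0P (I : Type) (F : set_system I) (f : I -> X) : Filter F ->
  (j (f i) @[i --> F] --> (0 : Xtau)) <->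
  (forall p, tau_seminorms p -> forall e, 0 < e -> \forall i \near F, p (f i) <= e).
Proof.
move=> FF; rewrite -(linear0 j) tau_cvgP.
by split=> h p pP e e0; have := h p pP e e0; apply: filterS => i; rewrite subr0.
Qed.

Lemma tau_cvg_seqP (u : nat -> X) (l : X) :
  (j (u n) @[n --> \oo] --> j l) <-> tau_cvg tau_seminorms u l.
Proof.
rewrite tau_cvgP; split=> h p pP e e0; have := h p pP e e0.
  by move=> [N _ hN]; exists N => n nN; apply: hN.
by move=> [N hN]; exists N => // n nN; apply: hN.
Qed.

Lemma near_at_right0P (Q : set R) :
  (\forall t \near 0^'+, Q t) <-> exists2 d, 0 < d & forall t, 0 < t < d -> Q t.
Proof.
split=> [[d /= d0 hd]|[d d0 hd]].
  exists d => // t /andP[t0 td]; apply: hd => //=.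
  by rewrite sub0r normrN gtr0_norm.
near=> t; apply: hd; apply/andP; split; near: t.
  exact: nbhs_right_gt.
exact: nbhs_right_lt.
Unshelve. all: by end_near. Qed.

Lemma tau_cvg_at_rightP (f : R -> X) (l : X) :
  (j (f t) @[t --> 0^'+] --> j l) <-> tau_cvg0 tau_seminorms f l.
Proof.
rewrite tau_cvgP; split=> h p pP e e0; have := h p pP e e0.
  by move/near_at_right0P.
by move=> h'; apply/near_at_right0P.
Qed.

Lemma norm_tau_two_topologies : two_topologies real_norm tau_seminorms.
Proof.
have norm_eq0 (x : V) : real_norm x <= 0 -> x = 0.
  by rewrite -norm_le_ofR ofR0 normr_le0 => /eqP.
split.
- exact: real_norm_seminorm.
- by move=> p [].
- move=> p [ps pn].
  have := @tau_coarser _ _ _ _ jS 0 (j @` [set x : X | p x <= 1]).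
  rewrite linear0 => /(_ (pn 1 ltr01)) /nbhs_norm0P[e /= e0 he].
  pose r := real_part k e.
  have re : ofR k r = e by rewrite ge0_real_part // ltW.
  have r0 : 0 < r by rewrite -(ltr_ofR k) ofR0 re.
  exists (2 / r) => [|x]; first by rewrite divr_ge0 // ltW.
  have n0 := seminorm_ge0 real_norm_seminorm x.
  have [/norm_eq0->|nx] := leP (real_norm x) 0.
    by rewrite (seminorm0 ps) (seminorm0 real_norm_seminorm) mulr0.
  pose c := r / 2 / real_norm x.
  have c0 : 0 < c by rewrite !divr_gt0.
  have [|y py] := he (c *: (x : V)).
    rewrite /= -re -[`|_|]ofR_norm ltr_ofR (seminormZ real_norm_seminorm).
    by rewrite gtr0_norm // /c divfK ?gt_eqF //; lra.
  move/j_inj => yE; move: py; rewrite /= yE (seminormZ ps) gtr0_norm //.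
  rewrite /c mulrAC ler_pdivrMr // mul1r mulrC -ler_pdivlMr ?divr_gt0 //.
  by rewrite invf_div mulrC.
- move=> x px; apply: contrapT => x0.
  have jx : j x != 0.
    by apply/eqP => jx; apply: x0; apply: j_inj; rewrite jx linear0.
  have := tau_hausdorff jS; rewrite open_hausdorff => /(_ _ _ jx).
  move=> [[A B]] /= [Ax B0] [oA oB AB].
  have [|p pP pB] := @tau_seminorm_nbhs B.
    by apply: open_nbhs_nbhs; split=> //; exact: set_mem.
  have Bx : B (j x) by apply: pB; rewrite px.
  have : (A `&` B) (j x) by split=> //; exact: set_mem.
  by rewrite (eqP AB).
- move=> u B uB uC.
  (* Rescaling to the unit ball needs B > 0; otherwise every [u n] is 0. *)
  have [B0|B0] := leP B 0.
    exists 0; first by rewrite (le_trans _ (uB 0%N)) //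
      (seminorm0 real_norm_seminorm) (seminorm_ge0 real_norm_seminorm).
    move=> p [ps _] e e0; exists 0%N => n _.
    rewrite (norm_eq0 (u n)) ?(le_trans (uB n)) // subrr (seminorm0 ps).
    exact: ltW.
  pose v n : V := B^-1 *: u n.
  have v1 n : `|v n : X| <= 1.
    rewrite -(ofR1 k) norm_le_ofR (seminormZ real_norm_seminorm).
    by rewrite gtr0_norm ?invr_gt0 // mulrC ler_pdivrMr // mul1r.
  have [|l [l1 vl]] := tau_seq_complete_ball jS v1.
    move=> U /tau_seminorm_nbhs[p [ps pn] pU].
    have [|N hN] := uC p (conj ps pn) (B / 2); first by rewrite divr_gt0.
    exists N => m n mN nN; apply: pU.
    rewrite -scalerBr (seminormZ ps) gtr0_norm ?invr_gt0 //.
    by rewrite mulrC ltr_pdivrMr //; have := hN m n mN nN; lra.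
  exists (B *: (l : V)).
    rewrite (seminormZ real_norm_seminorm) gtr0_norm // ler_piMr ?(ltW B0) //.
    by rewrite -norm_le_ofR ofR1.
  move/tau_cvg_seqP : vl => vl p pP e e0.
  have eB : 0 < e / B by rewrite divr_gt0.
  have [N hN] := vl p pP _ eB; exists N => n nN.
  have := hN n nN; rewrite ler_pdivlMr //.
  have [ps _] := pP; rewrite -[X in _ * X <= _](gtr0_norm B0) mulrC -(seminormZ ps).
  rewrite scalerBr scalerA divff ?gt_eqF // scale1r //.
Qed.

End NormAndTau.

Arguments real_norm {R K} k {X} x.
Arguments tau_seminorms {R K} k {X Xtau} j _.
Arguments norm_tau_two_topologies {R K} k {X Xtau j} _.

(** * Bi-continuous semigroups *)

Section Bicontinuous.
Context {R : realType} {K : numFieldType} (k : real_or_complex R K).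
Context {X : completeNormedModType K} {Xtau : tvsType K} (j : {linear X -> Xtau}).
Context (T : R -> {linear X -> X}).

Local Notation V := (realified k X).
Local Notation P := (tau_seminorms k j).
Local Notation nrm := (@real_norm _ _ k X).

Definition realified_sg (t : R) : {linear V -> V} := @realified_fun R K k X (T t).

Hypothesis jS : assumption_S j.

Lemma bicontinuous_bounded_semigroup :
  bicontinuous_semigroup k j T -> negative_growth_bound k T ->
  exists M, bounded_semigroup nrm P realified_sg M.
Proof.
move=> sg [w w0 [M M1 hM]]; exists M; split=> //.
- exact: sg0 sg.
- by move=> t s t0 s0 x; exact: (sgD sg).
- move=> t t0 x; rewrite -norm_le_ofR (le_trans (hM t t0 x)) //.
  rewrite -(ofR_norm x) -ofRM ler_ofR ler_wpM2r //.
    exact: seminorm_ge0 (real_norm_seminorm k) x.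
  rewrite ler_piMr ?(le_trans _ M1) // expR_le1.
  by rewrite mulrC mulr_ge0_le0 // ltW.
- move=> x; apply: (tau_cvg_at_rightP k jS (fun t => T t x) x).1.
  rewrite -[X in _ --> j X](sg0 sg x).
  have := @sg_tau_continuous _ _ _ _ _ _ _ sg x; rewrite subspace_continuousP => /(_ 0).
  rewrite /= in_itv /= lexx => /(_ isT).
  apply: cvg_trans; apply: cvg_app; apply: within_subset.
  by move=> t /ltW /=; rewrite in_itv /= andbT.
- move=> u B uB u0 p [ps pn] t0 e t00 e0.
  have ub : norm_bounded u by apply/(has_ubound_norm k); exists B => n _.
  have uc : j (u n) @[n --> \oo] --> (0 : Xtau).
    by rewrite -(linear0 j); apply: (tau_cvg_seqP k jS u 0).2.
  have [N _ hN] := sg_bi_equicontinuous sg ub uc t00 (pn e e0).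
  exists N => n nN s st; have [x px] := hN n nN s st.
  by move/(bij_inj (tau_bij jS)) => <-.
Qed.

Lemma generator_limP (x z : X) :
  generator_lim k j T x z <-> tau_cvg0 P (slope realified_sg x) z.
Proof.
rewrite -(tau_cvg_at_rightP k jS (slope realified_sg x : R -> X) z) /generator_lim.
suff -> : diff_quotient k T id x = slope realified_sg x by [].
by apply/funext => t; rewrite /slope realified_scaleE ofRV.
Qed.

Lemma generator_domP (x : X) : generator_dom k j T x <->
  (exists z, generator_lim k j T x z) /\ bounded_slope nrm realified_sg x.
Proof.
split=> -[h hb]; split=> //.
  move/(has_ubound_norm k) : hb => [B hB]; exists B => t /andP[t0 t1].
  rewrite /slope -[_ *: _]/(ofR k t^-1 *: (T t x - x)) ofRV.
  by apply: hB; rewrite /= in_itv /= t0.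
move: hb => [B hB]; apply/(has_ubound_norm k); exists B => t /=.
rewrite in_itv /= => t01; rewrite /diff_quotient -ofRV.
exact: hB.
Qed.

Context (M : R) (TP : bounded_semigroup nrm P realified_sg M).

Let XP := norm_tau_two_topologies k jS.

Lemma generator_eq (x z : X) : generator_lim k j T x z -> generator k j T x = z.
Proof.
move=> xz; apply: xget_unique => // z' xz'.
apply: (bij_inj (tau_bij jS)).
exact: (cvg_unique (tau_hausdorff jS) xz' xz).
Qed.

(** The value chosen by [resolvent] is forced: S / lam is a preimage of x under lam - A, and it is
    the only one. *)
Lemma generator_resolvent lam (x S : X) : 0 < lam ->
  laplace_limit P realified_sg lam (x : V) (S : V) ->
  generator k j T (resolvent k j T (ofR k lam) x) = S - x.
Proof.
move=> lam0 xS.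
pose y : V := lam^-1 *: (S : V).
have [yz yB] : is_generator nrm P realified_sg y (S - x : V).
  have := is_generatorZ XP lam^-1 (laplace_limit_generator XP TP lam0 xS).
  by rewrite scalerA mulVf ?gt_eqF // scale1r.
have yz' : generator_lim k j T y (S - x) by apply/generator_limP.
suff -> : resolvent k j T (ofR k lam) x = y by exact: generator_eq.
apply: xget_unique.
  split; first by apply/generator_domP; split=> //; exists (S - x).
  rewrite (generator_eq yz') -[ofR k lam *: _]/(lam *: y) /y scalerA.
  by rewrite divff ?gt_eqF // scale1r; exact: subKr.
move=> y' [/generator_domP[[z' yz'']] yB'] E.
rewrite (generator_eq yz'') in E.
apply: (resolvent_unique XP TP lam0 xS (z := z')) => //.
by split=> //; apply/generator_limP.
Qed.

End Bicontinuous.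

Theorem theorem4p23 (R : realType) (K : numFieldType)
    (k : real_or_complex R K) (X : completeNormedModType K) (Xtau : tvsType K)
    (j : {linear X -> Xtau}) (T : R -> {linear X -> X}) (alpha : R) :
  assumption_S j ->
  bicontinuous_semigroup k j T ->
  negative_growth_bound k T ->
  0 < alpha < 1 ->
  holder_space k j T alpha =
    [set x : X |
      j (scaled_AR k j T alpha x lambda) @[lambda --> +oo] --> (0 : Xtau) /\
      has_ubound [set `|scaled_AR k j T alpha x lambda| | lambda in `]0, +oo[]].
Proof.
move=> jS sg ngb al01.
have [M TP] := bicontinuous_bounded_semigroup jS sg ngb.
have XP := norm_tau_two_topologies k jS.
(* Positivity stays under the existential so that choice yields [S] on all of [R], with 0 as default
   for [lam <= 0]. *)
have hS (x : realified k X) lam : exists S, 0 < lam ->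
    laplace_limit (tau_seminorms k j) (realified_sg k T) lam x S.
  have [lam0|_] := ltP 0 lam; last by exists 0.
  by have [S xS] := laplace_limit_exists XP TP lam0 x; exists S.
apply/seteqP.
have equivs (x : X) : holder_space k j T alpha x <->
    j (scaled_AR k j T alpha x lambda) @[lambda --> +oo] --> (0 : Xtau) /\
    has_ubound [set `|scaled_AR k j T alpha x lambda| | lambda in `]0, +oo[].
  have /choice[S xS] := hS x.
  have quotE : diff_quotient k T (@powR R ^~ alpha) x =
      hoelder_quotient (realified_sg k T) alpha (x : realified k X).
    by apply/funext => t; rewrite /hoelder_quotient realified_scaleE ofRV.
  have ARE lam : 0 < lam -> scaled_AR k j T alpha x lam =
      scaled_resolvent alpha (x : realified k X) S lam.
    by move=> lam0; rewrite /scaled_AR (generator_resolvent jS TP lam0 (xS lam lam0)).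
  have -> : holder_space k j T alpha x <->
      tau_cvg0 (tau_seminorms k j)
        (hoelder_quotient (realified_sg k T) alpha (x : realified k X)) 0 /\
      exists C, forall t, 0 < t ->
        real_norm k
          (hoelder_quotient (realified_sg k T) alpha (x : realified k X) t) <= C.
    rewrite /holder_space /= quotE (has_ubound_norm k) -(linear0 j).
    rewrite (tau_cvg_at_rightP k jS).
    by split=> -[h [C hC]]; split=> //; exists C => t ht; apply: hC;
      move: ht; rewrite /= in_itv /= andbT.
  have -> : (j (scaled_AR k j T alpha x lambda) @[lambda --> +oo] --> (0 : Xtau) /\
      has_ubound [set `|scaled_AR k j T alpha x lambda| | lambda in `]0, +oo[]) <->
      (forall p, tau_seminorms k j p -> forall e, 0 < e ->
        exists2 L, 0 < L & forall lam, L < lam ->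
          p (scaled_resolvent alpha (x : realified k X) S lam) <= e) /\
      exists C, forall lam, 0 < lam ->
        real_norm k (scaled_resolvent alpha (x : realified k X) S lam) <= C.
    rewrite (has_ubound_norm k) (tau_cvg0P k jS).
    split=> -[h [C hC]]; split.
    - move=> p pP e e0; have [L [_ hL]] := h p pP e e0.
      (* The threshold of a limit at infinity may be negative, while the scaled resolvent is
         identified for positive [lam] only. *)
      exists (Num.max L 1); first by rewrite lt_max ltr01 orbT.
      move=> lam; rewrite gt_max => /andP[Ll l1]; rewrite -ARE ?(lt_trans ltr01) //.
      exact: hL.
    - exists C => lam lam0; rewrite -ARE //; apply: hC.
      by rewrite /= in_itv /= lam0.
    - move=> p pP e e0; have [L L0 hL] := h p pP e e0.
      exists L; split; first exact: num_real.
      by move=> lam Ll; rewrite ARE ?(lt_trans L0) //; exact: hL.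
    - exists C => lam; rewrite /= in_itv /= andbT => lam0; rewrite ARE //.
      exact: hC.
  split=> -[h [C hC]]; split.
  - exact: (scaled_resolvent_cvg0 XP TP al01 xS hC h).
  - by exists (C + C); exact: (scaled_resolvent_bounded XP TP al01 xS hC).
  - exact: (hoelder_quotient_cvg0 XP TP xS hC h).
  - by exists (3 * (M * C)); exact: (hoelder_quotient_bounded XP TP xS hC).
by split=> x /equivs.
Qed.
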